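(* Let $k\geq 0$ be an integer. For all modules $M$ and $N$ in $\mathcal{U}_{k}$ and all integers $s>k$, $$\mathrm{Ext}^{s}_{\mathcal{U}_{k}}(M,N)=0.$$
   Context: A ringoid is a small preadditive category. A left module over a ringoid is a covariant additive functor from it to abelian groups; module maps are natural transformations. An ideal of a ringoid is a choice of subgroups of all morphism groups closed under composition on either side with arbitrary morphisms; quotients by ideals are formed on morphism groups. A subringoid has all objects, and its morphism sets are subgroups closed under composition and containing identities. Let $A$ be the mod 2 Steenrod algebra. Let $\mathcal{A}$ be the ringoid whose objects are all integers, with $\mathcal{A}(a,b)$ the degree $b-a$ part of $A$ and composition given by multiplication ($g\circ f=gf$). Let $\mathcal{Q}$ be the quotient of $\mathcal{A}$ by the ideal generated by the morphisms $\mathrm{Sq}^{i}:n\to n+i$ with $i\geq 0$ and $i>n$ (for $n<0$ this includes the identity $\mathrm{Sq}^0$ of $n$); left $\mathcal{Q}$-modules are exactly unstable $A$-modules. For $k\geq 0$ let $\mathcal{Q}_{k}$ be the subringoid of $\mathcal{Q}$ generated by the morphisms $\mathrm{Sq}^{i}:n\to n+i$ with $i\geq 0$ and $n-i<k$. $\mathcal{U}_{k}$ is the category of left $\mathcal{Q}_{k}$-modules; it is an abelian category with enough projectives. *)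

(* Defs.v *)
From HB Require Import structures.
From mathcomp Require Import all_boot all_order all_algebra.
From mathcomp Require Import ring_quotient finmap.
From mathcomp Require Import boolp.
From mathcomp.multinomials Require Import monalg.

Set Implicit Arguments.
Unset Strict Implicit.
Unset Printing Implicit Defensive.

Import GRing.Theory.
Local Open Scope ring_scope.
Local Open Scope quotient_scope.

Record sgroup (V : zmodType) := SGroup {
  sg_mem :> V -> Prop;
  sg0 : sg_mem 0;
  sgB : forall x y, sg_mem x -> sg_mem y -> sg_mem (x - y) }.

Section Subgroup.
Variables (V : zmodType) (G : sgroup V).

Definition sgpred (x : V) : bool := `[< G x >].

Fact sgpred_closed : zmod_closed sgpred.
Proof.
split=> [|x y]; first by apply/asboolP; exact: sg0.
by move=> /asboolP Gx /asboolP Gy; apply/asboolP; exact: sgB.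
Qed.

HB.instance Definition _ := GRing.isZmodClosed.Build V sgpred sgpred_closed.

Lemma sgN x : G x -> G (- x).
Proof. by move=> Gx; rewrite -sub0r; apply: sgB => //; exact: sg0. Qed.

Lemma sgD x y : G x -> G y -> G (x + y).
Proof. by move=> Gx Gy; rewrite -[y]opprK; apply: sgB => //; exact: sgN. Qed.

Record ssub := SSub { ssval :> V; sspred : sgpred ssval }.
HB.instance Definition _ := [isSub for ssval].
HB.instance Definition _ := [Choice of ssub by <:].
HB.instance Definition _ := [SubChoice_isSubZmodule of ssub by <:].

Lemma ssubP (x : ssub) : G (val x).
Proof. by apply/asboolP; exact: (valP x). Qed.

Definition mkssub x (Gx : G x) : ssub := SSub (asboolT Gx).

Definition squot : zmodType :=
  Quotient.quot (GRing.ZmodClosed.clone V sgpred _).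

Definition qproj (x : V) : squot := \pi_squot x.

Lemma qproj_eq x y : qproj x = qproj y <-> G (x - y).
Proof.
rewrite /qproj; split.
  by move/eqP; rewrite -Quotient.idealrBE => /asboolP.
by move=> Gxy; apply/eqP; rewrite -Quotient.idealrBE; exact/asboolP.
Qed.

Lemma qproj_surj (q : squot) : exists x, q = qproj x.
Proof. by exists (repr q); rewrite /qproj reprK. Qed.

Lemma qprojB x y : qproj (x - y) = qproj x - qproj y.
Proof. exact: raddfB. Qed.

Lemma qprojD x y : qproj (x + y) = qproj x + qproj y.
Proof. exact: raddfD. Qed.
End Subgroup.

Record rideal (R : pzRingType) := RIdeal {
  ri_sg :> sgroup R;
  riMl : forall r x, ri_sg x -> ri_sg (r * x);
  riMr : forall r x, ri_sg x -> ri_sg (x * r) }.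

Section RIdealGen.
Variables (R : pzRingType) (S : R -> Prop).

Definition rigen_mem (x : R) : Prop :=
  forall I : rideal R, (forall y, S y -> I y) -> I x.

Definition rigen_sg : sgroup R.
Proof.
exists rigen_mem => [I _|x y Ix Iy I SI]; first exact: sg0.
by apply: sgB; [exact: Ix | exact: Iy].
Defined.

Definition rigen : rideal R.
Proof.
exists rigen_sg => r x Ix I SI; first by apply: riMl; exact: Ix.
by apply: riMr; exact: Ix.
Defined.
End RIdealGen.

Section RQuot.
Variables (R : pzRingType) (I : rideal R).

Definition rquot : Type := squot I.
HB.instance Definition _ := GRing.Zmodule.on rquot.

Definition rproj (x : R) : rquot := qproj I x.
Definition rq_mul (p q : rquot) : rquot := rproj (repr p * repr q).

Lemma rproj_mul x y : rq_mul (rproj x) (rproj y) = rproj (x * y).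
Proof.
apply/qproj_eq; set x' := repr _; set y' := repr _.
have -> : x' * y' - x * y = (x' - x) * y' + x * (y' - y).
  by rewrite mulrBl mulrBr addrA subrK.
by apply: sgD; [apply: riMr | apply: riMl]; apply/qproj_eq;
  rewrite /qproj reprK.
Qed.

Lemma rproj_surj (q : rquot) : exists x, q = rproj x.
Proof. exact: qproj_surj. Qed.

Lemma rprojB x y : rproj (x - y) = rproj x - rproj y.
Proof. exact: qprojB. Qed.

Lemma rprojD x y : rproj (x + y) = rproj x + rproj y.
Proof. exact: qprojD. Qed.

Fact rq_mulA : associative rq_mul.
Proof.
move=> p q r.
have [x ->] := rproj_surj p; have [y ->] := rproj_surj q.
by have [z ->] := rproj_surj r; rewrite !rproj_mul mulrA.
Qed.

Fact rq_mul1 : left_id (rproj 1) rq_mul.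
Proof. by move=> p; have [x ->] := rproj_surj p; rewrite rproj_mul mul1r. Qed.

Fact rq_mulr1 : right_id (rproj 1) rq_mul.
Proof. by move=> p; have [x ->] := rproj_surj p; rewrite rproj_mul mulr1. Qed.

Fact rq_mulDl : left_distributive rq_mul +%R.
Proof.
move=> p q r.
have [x ->] := rproj_surj p; have [y ->] := rproj_surj q.
have [z ->] := rproj_surj r.
by rewrite -rprojD !rproj_mul -rprojD mulrDl.
Qed.

Fact rq_mulDr : right_distributive rq_mul +%R.
Proof.
move=> p q r.
have [x ->] := rproj_surj p; have [y ->] := rproj_surj q.
have [z ->] := rproj_surj r.
by rewrite -rprojD !rproj_mul -rprojD mulrDr.
Qed.

HB.instance Definition _ := GRing.Zmodule_isPzRing.Build rquot
  rq_mulA rq_mul1 rq_mulr1 rq_mulDl rq_mulDr.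

Lemma rprojM x y : rproj (x * y) = rproj x * rproj y.
Proof. by rewrite -rproj_mul. Qed.
End RQuot.

(* Noncommutative polynomials over F_2 in letters indexed by nat. *)
Definition freealg : pzRingType := {malg 'F_2[{fmonom nat}]}.

Definition fsq (i : nat) : freealg := << 1 *g fmu i >>.

(* Sq^0 = 1, and for 0 < a < 2b the Adem relation for Sq^a Sq^b; there
   c <= a./2 < b, so that the subtractions below are not truncated. *)
Inductive steenrod_rel : freealg -> Prop :=
| rel_sq0 : steenrod_rel (fsq 0 - 1)
| rel_adem (a b : nat) of (0 < a)%N & (a < b.*2)%N :
    steenrod_rel (fsq a * fsq b -
      \sum_(c < a./2.+1)
         (fsq (a + b - c)%N * fsq c) *+ 'C(b - c - 1, a - c.*2)).

Definition steenrod : pzRingType := rquot (rigen steenrod_rel).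

Definition Sq (i : nat) : steenrod := rproj (rigen steenrod_rel) (fsq i).

(* The letter i of a word has degree i. *)
Definition wdeg (w : {fmonom nat}) : nat := sumn w.

Definition fhomog (n : int) (x : freealg) : Prop :=
  forall w, w \in msupp x -> (wdeg w)%:Z = n.

Definition shomog_mem (n : int) (y : steenrod) : Prop :=
  exists2 x, fhomog n x & y = rproj _ x.

Lemma fhomogB n x y : fhomog n x -> fhomog n y -> fhomog n (x - y).
Proof.
move=> hx hy w /(fsubsetP (msuppB_le x y)); rewrite in_fsetU.
by case/orP; [exact: hx | exact: hy].
Qed.

Lemma fhomogM m n x y : fhomog m x -> fhomog n y -> fhomog (m + n) (x * y).
Proof.
move=> hx hy w /msuppM_le [u [v [xu yv ->]]].
by rewrite -(hx _ xu) -(hy _ yv) /wdeg fmM sumn_cat PoszD.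
Qed.

Lemma Sq_homog (i : nat) : shomog_mem i%:Z (Sq i).
Proof.
exists (fsq i) => // w; rewrite msuppU1 in_fset1 => /eqP ->.
by rewrite /wdeg fmU /= addn0.
Qed.

Definition shomog (n : int) : sgroup steenrod.
Proof.
exists (shomog_mem n) => [|_ _ [x hx ->] [y hy ->]].
  exists 0; first by move=> w; rewrite msupp0.
  exact: esym (@raddf0 _ _ _).
by exists (x - y); [exact: fhomogB | rewrite rprojB].
Defined.

Record ringoid := Ringoid {
  rob :> Type;
  rhom : rob -> rob -> zmodType;
  rid : forall a, rhom a a;
  rcomp : forall a b c, rhom b c -> rhom a b -> rhom a c;
  rcompA : forall a b c d (h : rhom c d) (g : rhom b c) (f : rhom a b),
    rcomp h (rcomp g f) = rcomp (rcomp h g) f;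
  rcomp1m : forall a b (f : rhom a b), rcomp (rid b) f = f;
  rcompm1 : forall a b (f : rhom a b), rcomp f (rid a) = f;
  rcompDl : forall a b c (g g' : rhom b c) (f : rhom a b),
    rcomp (g + g') f = rcomp g f + rcomp g' f;
  rcompDr : forall a b c (g : rhom b c) (f f' : rhom a b),
    rcomp g (f + f') = rcomp g f + rcomp g f' }.

Arguments rid {r} a.
Arguments rcomp {r a b c} g f.

Section RingoidTheory.
Variable R : ringoid.

Lemma rcompBl a b c (g g' : rhom b c) (f : rhom (r := R) a b) :
  rcomp (g - g') f = rcomp g f - rcomp g' f.
Proof. by apply/eqP; rewrite eq_sym subr_eq -rcompDl subrK. Qed.

Lemma rcompBr a b c (g : rhom b c) (f f' : rhom (r := R) a b) :
  rcomp g (f - f') = rcomp g f - rcomp g f'.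
Proof. by apply/eqP; rewrite eq_sym subr_eq -rcompDr subrK. Qed.

Definition morset := forall a b : R, rhom a b -> Prop.

Record oideal := OIdeal {
  oi_sg :> forall a b : R, sgroup (rhom a b);
  oi_compl : forall a b c (g : rhom b c) (f : rhom a b),
    oi_sg a b f -> oi_sg a c (rcomp g f);
  oi_compr : forall a b c (g : rhom b c) (f : rhom a b),
    oi_sg b c g -> oi_sg a c (rcomp g f) }.

Record subringoid := SubRingoid {
  so_sg :> forall a b : R, sgroup (rhom a b);
  so_id : forall a, so_sg a a (rid a);
  so_comp : forall a b c (g : rhom b c) (f : rhom a b),
    so_sg b c g -> so_sg a b f -> so_sg a c (rcomp g f) }.

Section Generated.
Variable S : morset.

Definition oigen_mem (a b : R) (f : rhom a b) : Prop :=
  forall I : oideal, (forall (c d : R) (g : rhom c d), S g -> I c d g) -> I a b f.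

Definition oigen_sg (a b : R) : sgroup (rhom a b).
Proof.
exists (@oigen_mem a b) => [I _|x y Ix Iy I SI]; first exact: sg0.
by apply: sgB; [exact: Ix | exact: Iy].
Defined.

Definition oigen : oideal.
Proof.
exists oigen_sg => a b c g f Ix I SI; first by apply: oi_compl; exact: Ix.
by apply: oi_compr; exact: Ix.
Defined.

Definition sogen_mem (a b : R) (f : rhom a b) : Prop :=
  forall T : subringoid,
    (forall (c d : R) (g : rhom c d), S g -> T c d g) -> T a b f.

Definition sogen_sg (a b : R) : sgroup (rhom a b).
Proof.
exists (@sogen_mem a b) => [I _|x y Ix Iy I SI]; first exact: sg0.
by apply: sgB; [exact: Ix | exact: Iy].
Defined.

Definition sogen : subringoid.
Proof.
exists sogen_sg => [a T _|a b c g f Tg Tf T ST]; first exact: so_id.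
by apply: so_comp; [exact: Tg | exact: Tf].
Defined.
End Generated.

Section Quotient.
Variable I : oideal.

Definition qcomp a b c (g : squot (I b c)) (f : squot (I a b)) :
    squot (I a c) :=
  qproj (I a c) (rcomp (repr g) (repr f)).

Lemma qcompE a b c (g : rhom b c) (f : rhom a b) :
  qcomp (qproj (I b c) g) (qproj (I a b) f) = qproj (I a c) (rcomp g f).
Proof.
rewrite /qcomp; set g' := repr _; set f' := repr _; apply/qproj_eq.
have -> : rcomp g' f' - rcomp g f = rcomp (g' - g) f' + rcomp g (f' - f).
  by rewrite rcompBl rcompBr addrA subrK.
by apply: sgD; [apply: oi_compr | apply: oi_compl]; apply/qproj_eq;
  rewrite /qproj reprK.
Qed.

Definition quot_ringoid : ringoid.
Proof.
refine (@Ringoid R (fun a b => squot (I a b))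
  (fun a => qproj (I a a) (rid a)) qcomp _ _ _ _ _).
- move=> a b c d h g f.
  have [x ->] := qproj_surj h; have [y ->] := qproj_surj g.
  by have [z ->] := qproj_surj f; rewrite !qcompE rcompA.
- by move=> a b f; have [x ->] := qproj_surj f; rewrite qcompE rcomp1m.
- by move=> a b f; have [x ->] := qproj_surj f; rewrite qcompE rcompm1.
- move=> a b c g g' f.
  have [x ->] := qproj_surj g; have [y ->] := qproj_surj g'.
  have [z ->] := qproj_surj f.
  by rewrite -qprojD !qcompE rcompDl qprojD.
- move=> a b c g f f'.
  have [x ->] := qproj_surj g; have [y ->] := qproj_surj f.
  have [z ->] := qproj_surj f'.
  by rewrite -qprojD !qcompE rcompDr qprojD.
Defined.
End Quotient.

Section Sub.
Variable T : subringoid.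

Definition sub_ringoid : ringoid.
Proof.
refine (@Ringoid R (fun a b => ssub (T a b))
  (fun a => mkssub (so_id T a))
  (fun a b c g f => mkssub (so_comp (ssubP g) (ssubP f))) _ _ _ _ _).
- by move=> a b c d h g f; apply: val_inj; rewrite /= rcompA.
- by move=> a b f; apply: val_inj; rewrite /= rcomp1m.
- by move=> a b f; apply: val_inj; rewrite /= rcompm1.
- by move=> a b c g g' f; apply: val_inj; rewrite /= rcompDl.
- by move=> a b c g f f'; apply: val_inj; rewrite /= rcompDr.
Defined.
End Sub.

End RingoidTheory.

Record lmodule (R : ringoid) := LModule {
  mob :> R -> zmodType;
  mact : forall a b, rhom a b -> mob a -> mob b;
  mact1 : forall a (x : mob a), mact (rid a) x = x;
  mactM : forall a b c (g : rhom b c) (f : rhom a b) (x : mob a),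
    mact (rcomp g f) x = mact g (mact f x);
  mactDl : forall a b (f g : rhom a b) (x : mob a),
    mact (f + g) x = mact f x + mact g x;
  mactDr : forall a b (f : rhom a b) (x y : mob a),
    mact f (x + y) = mact f x + mact f y }.

Arguments mact {R} l {a b} f x.

Section Modules.
Variable R : ringoid.
Implicit Types L M N : lmodule R.

Record lmap M N := MMap {
  mapp :> forall a, M a -> N a;
  mappD : forall a (x y : M a), mapp (x + y) = mapp x + mapp y;
  mapp_nat : forall a b (f : rhom a b) (x : M a),
    mapp (mact M f x) = mact N f (mapp x) }.

Arguments mapp {M N} l {a} x.

Lemma lmapP M N (u v : lmap M N) : (forall a (x : M a), u a x = v a x) -> u = v.
Proof.
case: u v => [u uD uN] [v vD vN] /= uv.
have E : u = v by apply: functional_extensionality_dep => a; apply/funext => x.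
by case: _ / E in vD vN *; congr MMap; exact: Prop_irrelevance.
Qed.

HB.instance Definition _ M N := gen_eqMixin (lmap M N).
HB.instance Definition _ M N := gen_choiceMixin (lmap M N).

Lemma mact0 M a b (f : rhom a b) : mact M f 0 = 0.
Proof. by apply: (@addrI _ (mact M f 0)); rewrite -mactDr !addr0. Qed.

Lemma mactN M a b (f : rhom a b) x : mact M f (- x) = - mact M f x.
Proof. by apply/eqP; rewrite -addr_eq0 -mactDr addNr mact0. Qed.

Lemma mapp0 M N (u : lmap M N) a : u a 0 = 0.
Proof. by apply: (@addrI _ (u a 0)); rewrite -mappD !addr0. Qed.

Lemma mappN M N (u : lmap M N) a (x : M a) : u a (- x) = - u a x.
Proof. by apply/eqP; rewrite -addr_eq0 -mappD addNr mapp0. Qed.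

Definition lmap_zero M N : lmap M N.
Proof.
by exists (fun a _ => 0) => [a x y|a b f x]; rewrite ?addr0 ?mact0.
Defined.

Definition lmap_opp M N (u : lmap M N) : lmap M N.
Proof.
exists (fun a x => - u a x) => [a x y|a b f x].
  by rewrite mappD opprD.
by rewrite mapp_nat mactN.
Defined.

Definition lmap_add M N (u v : lmap M N) : lmap M N.
Proof.
exists (fun a x => u a x + v a x) => [a x y|a b f x].
  by rewrite !mappD addrACA.
by rewrite !mapp_nat mactDr.
Defined.

Fact lmap_addA M N : associative (@lmap_add M N).
Proof. by move=> u v w; apply: lmapP => a x /=; rewrite addrA. Qed.
Fact lmap_addC M N : commutative (@lmap_add M N).
Proof. by move=> u v; apply: lmapP => a x /=; rewrite addrC. Qed.
Fact lmap_add0 M N : left_id (lmap_zero M N) (@lmap_add M N).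
Proof. by move=> u; apply: lmapP => a x /=; rewrite add0r. Qed.
Fact lmap_addN M N : left_inverse (lmap_zero M N) (@lmap_opp M N) (@lmap_add M N).
Proof. by move=> u; apply: lmapP => a x /=; rewrite addNr. Qed.

HB.instance Definition _ M N := GRing.isZmodule.Build (lmap M N)
  (@lmap_addA M N) (@lmap_addC M N) (@lmap_add0 M N) (@lmap_addN M N).

Definition lmap_comp L M N (v : lmap M N) (u : lmap L M) : lmap L N.
Proof.
exists (fun a x => v a (u a x)) => [a x y|a b f x]; first by rewrite !mappD.
by rewrite !mapp_nat.
Defined.

Definition msurj M N (u : lmap M N) : Prop :=
  forall a (y : N a), exists x, u a x = y.

Definition projective (P : lmodule R) : Prop :=
  forall M N (g : lmap M N) (f : lmap P N), msurj g ->
    exists h : lmap P M, lmap_comp g h = f.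

Record proj_resolution M := ProjResolution {
  res :> nat -> lmodule R;
  res_proj : forall n, projective (res n);
  res_d : forall n, lmap (res n.+1) (res n);
  res_aug : lmap (res 0%N) M;
  res_aug_surj : msurj res_aug;
  res_exact0 : forall a (x : res 0%N a),
    res_aug a x = 0 <-> exists y, res_d 0 a y = x;
  res_exactS : forall n a (x : res n.+1 a),
    res_d n a x = 0 <-> exists y, res_d n.+1 a y = x }.


(* The free module on the elements of M: formal additive combinations of
   f(x), identified when they agree under every assignment of the generators
   x to elements of a module. *)
Section Free.
Variable M : lmodule R.

Inductive fterm (b : R) : Type :=
| FGen a (x : M a) (f : rhom a b)
| FZero
| FOpp (s : fterm b)
| FAdd (s t : fterm b).

Definition assignment (X : lmodule R) := forall a, M a -> X a.

Fixpoint feval (X : lmodule R) (e : assignment X) b (s : fterm b) : X b :=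
  match s with
  | FGen a x f => mact X f (e a x)
  | FZero => 0
  | FOpp s => - feval e s
  | FAdd s t => feval e s + feval e t
  end.

Fixpoint fterm_act b c (g : rhom b c) (s : fterm b) : fterm c :=
  match s with
  | FGen a x f => FGen x (rcomp g f)
  | FZero => FZero c
  | FOpp s => FOpp (fterm_act g s)
  | FAdd s t => FAdd (fterm_act g s) (fterm_act g t)
  end.

Lemma feval_act X (e : assignment X) b c (g : rhom b c) (s : fterm b) :
  feval e (fterm_act g s) = mact X g (feval e s).
Proof.
elim: s => [a x f||s IHs|s IHs t IHt] /=.
- by rewrite mactM.
- by rewrite mact0.
- by rewrite IHs mactN.
- by rewrite IHs IHt mactDr.
Qed.

Lemma feval_map X Y (u : lmap X Y) (e : assignment X) b (s : fterm b) :
  u b (feval e s) = feval (fun a x => u a (e a x)) s.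
Proof.
elim: s => [a x f||s IHs|s IHs t IHt] /=.
- exact: mapp_nat.
- exact: mapp0.
- by rewrite mappN IHs.
- by rewrite mappD IHs IHt.
Qed.

Lemma feval_ext X (e e' : assignment X) b (s : fterm b) :
  (forall a (x : M a), e a x = e' a x) -> feval e s = feval e' s.
Proof. by move=> E; elim: s => //= [a x f|s ->|s -> t ->] //; rewrite E. Qed.

Definition fequiv_prop b (s t : fterm b) : Prop :=
  forall X (e : assignment X), feval e s = feval e t.
Definition fequiv b (s t : fterm b) : bool := `[< fequiv_prop s t >].

HB.instance Definition _ b := gen_eqMixin (fterm b).
HB.instance Definition _ b := gen_choiceMixin (fterm b).

Lemma fequiv_class b : equiv_class_of (@fequiv b).
Proof.
split=> [s|s t|t s r]; first by apply/asboolP.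
  by apply/asboolP/asboolP => H X e; rewrite H.
by move=> /asboolP Hst /asboolP Htr; apply/asboolP => X e; rewrite Hst Htr.
Qed.
Canonical fequiv_equiv b := EquivRelPack (fequiv_class b).
Canonical fequiv_encModRel b := defaultEncModRel (@fequiv b).

Definition fquot b := {eq_quot (@fequiv b)}.
HB.instance Definition _ b := Choice.on (fquot b).

Definition fpi b (s : fterm b) : fquot b := \pi_(fquot b) s.
Definition qeval X (e : assignment X) b (q : fquot b) : X b := feval e (repr q).

Lemma fpi_eq b (s t : fterm b) : fpi s = fpi t <-> fequiv_prop s t.
Proof.
rewrite /fpi; split=> [/eqP|st]; first by rewrite eqmodE => /asboolP.
by apply/eqP; rewrite eqmodE; apply/asboolP.
Qed.

Lemma fpi_repr b (q : fquot b) : fpi (repr q) = q.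
Proof. exact: reprK. Qed.

Lemma qevalE X (e : assignment X) b (s : fterm b) : qeval e (fpi s) = feval e s.
Proof. by have /fpi_eq := fpi_repr (fpi s); apply. Qed.

Lemma fquotP b (p q : fquot b) :
  (forall X (e : assignment X), qeval e p = qeval e q) -> p = q.
Proof. by move=> H; rewrite -[p]fpi_repr -[q]fpi_repr; apply/fpi_eq. Qed.

Definition fq_zero b : fquot b := fpi (FZero b).
Definition fq_opp b (p : fquot b) : fquot b := fpi (FOpp (repr p)).
Definition fq_add b (p q : fquot b) : fquot b := fpi (FAdd (repr p) (repr q)).

Lemma qeval_zero X (e : assignment X) b : qeval e (fq_zero b) = 0.
Proof. exact: qevalE. Qed.
Lemma qeval_opp X (e : assignment X) b (p : fquot b) :
  qeval e (fq_opp p) = - qeval e p.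
Proof. exact: qevalE. Qed.
Lemma qeval_add X (e : assignment X) b (p q : fquot b) :
  qeval e (fq_add p q) = qeval e p + qeval e q.
Proof. exact: qevalE. Qed.

Fact fq_addA b : associative (@fq_add b).
Proof. by move=> p q r; apply: fquotP => X e; rewrite !qeval_add addrA. Qed.
Fact fq_addC b : commutative (@fq_add b).
Proof. by move=> p q; apply: fquotP => X e; rewrite !qeval_add addrC. Qed.
Fact fq_add0 b : left_id (fq_zero b) (@fq_add b).
Proof.
by move=> p; apply: fquotP => X e; rewrite qeval_add qeval_zero add0r.
Qed.
Fact fq_addN b : left_inverse (fq_zero b) (@fq_opp b) (@fq_add b).
Proof.
by move=> p; apply: fquotP => X e; rewrite qeval_add qeval_zero qeval_opp addNr.
Qed.

HB.instance Definition _ b := GRing.isZmodule.Build (fquot b)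
  (@fq_addA b) (@fq_addC b) (@fq_add0 b) (@fq_addN b).

Lemma qevalD X (e : assignment X) b (p q : fquot b) :
  qeval e (p + q) = qeval e p + qeval e q.
Proof. exact: qevalE. Qed.

Definition fq_act b c (g : rhom b c) (p : fquot b) : fquot c :=
  fpi (fterm_act g (repr p)).

Lemma qeval_act X (e : assignment X) b c (g : rhom b c) (p : fquot b) :
  qeval e (fq_act g p) = mact X g (qeval e p).
Proof. by rewrite qevalE feval_act. Qed.

Definition free_module : lmodule R.
Proof.
refine (@LModule R (fun b => fquot b) fq_act _ _ _ _).
- by move=> a x; apply: fquotP => X e; rewrite qeval_act mact1.
- by move=> a b c g f x; apply: fquotP => X e; rewrite !qeval_act mactM.
- by move=> a b f g x; apply: fquotP => X e; rewrite qevalD !qeval_act mactDl.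
- by move=> a b f x y; apply: fquotP => X e; rewrite !(qeval_act, qevalD) mactDr.
Defined.

Definition free_ext X (e : assignment X) : lmap free_module X.
Proof.
exists (fun b => qeval e (b := b)) => [b p q|b c g p]; first exact: qevalD.
exact: qeval_act.
Defined.

Definition fgen : assignment free_module := fun a x => fpi (FGen x (rid a)).

Lemma free_ext_gen X (e : assignment X) a (x : M a) :
  free_ext e a (fgen x) = e a x.
Proof. by rewrite /= qevalE /= mact1. Qed.

Lemma feval_fgen b (s : fterm b) : feval fgen s = fpi s.
Proof.
apply: fquotP => X e.
have := feval_map (free_ext e) fgen s => /= ->; rewrite qevalE.
apply: feval_ext => a x; exact: free_ext_gen.
Qed.

Lemma free_projective : projective free_module.
Proof.
move=> X Y g f gS.
pose e : assignment X := fun a x => projT1 (cid (gS a (f a (fgen x)))).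
exists (free_ext e); apply: lmapP => b p /=.
rewrite -[p in RHS]fpi_repr -feval_fgen feval_map /qeval feval_map.
apply: feval_ext => a x.
by rewrite /e; case: cid.
Qed.

Definition free_cover : lmap free_module M := free_ext (fun a x => x).

Lemma free_cover_surj : msurj free_cover.
Proof. by move=> a y; exists (fgen y); exact: free_ext_gen. Qed.
End Free.

Section Kernel.
Variables (M N : lmodule R) (u : lmap M N).

Definition ker_sg (a : R) : sgroup (M a).
Proof.
exists (fun x => u a x = 0) => [|x y ux uy]; first exact: mapp0.
by rewrite mappD mappN ux uy subr0.
Defined.

Lemma ker_act a b (f : rhom a b) (x : ssub (ker_sg a)) :
  ker_sg b (mact M f (ssval x)).
Proof. by rewrite /= mapp_nat (ssubP x) mact0. Qed.

Definition ker_module : lmodule R.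
Proof.
refine (@LModule R (fun a => ssub (ker_sg a))
  (fun a b f x => mkssub (ker_act f x)) _ _ _ _).
- by move=> a x; apply: val_inj; rewrite /= mact1.
- by move=> a b c g f x; apply: val_inj; rewrite /= mactM.
- by move=> a b f g x; apply: val_inj; rewrite /= mactDl.
- by move=> a b f x y; apply: val_inj; rewrite /= mactDr.
Defined.

Definition ker_incl : lmap ker_module M.
Proof. by exists (fun a (x : ssub (ker_sg a)) => ssval x). Defined.
End Kernel.

Fixpoint syzygy M (n : nat) : lmodule R :=
  if n is m.+1 then ker_module (free_cover (syzygy M m)) else M.

Lemma free_resolution_exact M a (x : free_module M a) :
  free_cover M a x = 0 <->
  exists y, lmap_comp (ker_incl (free_cover M))
              (free_cover (ker_module (free_cover M))) a y = x.
Proof.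
split=> [x0|[y <-]].
  have [y yx] := free_cover_surj (M := ker_module (free_cover M))
    (mkssub (x0 : ker_sg (free_cover M) a x)).
  by exists y; have := congr1 (@ssval _ _) yx.
exact: ssubP (free_cover (ker_module (free_cover M)) a y).
Qed.

Definition free_resolution M : proj_resolution M.
Proof.
refine (@ProjResolution M (fun n => free_module (syzygy M n)) _
  (fun n => lmap_comp (ker_incl (free_cover (syzygy M n)))
              (free_cover (syzygy M n.+1)))
  (free_cover M) _ _ _).
- by move=> n; exact: free_projective.
- exact: free_cover_surj.
- exact: free_resolution_exact.
- move=> n a x; rewrite -(free_resolution_exact (M := syzygy M n.+1)).
  by split=> [x0|/= ->] //; exact: val_inj.
Defined.

Section Ext.
Variables (M N : lmodule R) (P : proj_resolution M).

Definition cochain (s : nat) : zmodType := lmap (P s) N.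

Definition cobound (s : nat) (f : cochain s) : cochain s.+1 :=
  lmap_comp f (res_d P s).

Lemma coboundB s (f g : cochain s) : cobound (f - g) = cobound f - cobound g.
Proof. by apply: lmapP. Qed.

Lemma cobound0 s : cobound (0 : cochain s) = 0.
Proof. by apply: lmapP. Qed.

Definition cocycles (s : nat) : sgroup (cochain s).
Proof.
exists (fun f => cobound f = 0) => [|f g Zf Zg]; first exact: cobound0.
by rewrite coboundB Zf Zg subr0.
Defined.

Definition coboundary (s : nat) : cochain s -> Prop :=
  match s with
  | 0%N => fun f => f = 0
  | t.+1 => fun f => exists g : cochain t, cobound g = f
  end.

Definition coboundaries (s : nat) : sgroup (ssub (cocycles s)).
Proof.
exists (fun f => coboundary (ssval f)).
  by case: s => [|t] //=; exists 0; exact: cobound0.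
case: s => [|t] /= f g; first by move=> -> ->; rewrite subr0.
by move=> [f' <-] [g' <-]; exists (f' - g'); exact: coboundB.
Defined.

(* Ext^s(M, N), computed from the projective resolution P of M; free_resolution
   provides one, and up to isomorphism the group does not depend on P. *)
Definition Ext (s : nat) : zmodType := squot (coboundaries s).
End Ext.

End Modules.

Arguments Ext {R M} N P s.

Lemma shomog1 (a : int) : shomog (a - a) 1.
Proof.
rewrite subrr; exists 1 => // w.
by rewrite msuppU1 in_fset1 => /eqP ->; rewrite /wdeg fm1.
Qed.

Lemma shomogM (a b c : int) (y z : steenrod) :
  shomog (c - b) y -> shomog (b - a) z -> shomog (c - a) (y * z).
Proof.
move=> [x hx ->] [x' hx' ->]; exists (x * x'); last by rewrite rprojM.
by rewrite -[c](subrK b) -addrA; exact: fhomogM.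
Qed.

Definition ringoidA : ringoid.
Proof.
refine (@Ringoid int (fun a b => ssub (shomog (b - a)))
  (fun a => mkssub (shomog1 a))
  (fun a b c g f => mkssub (shomogM (ssubP g) (ssubP f))) _ _ _ _ _).
- by move=> a b c d h g f; apply: val_inj; rewrite /= mulrA.
- by move=> a b f; apply: val_inj; rewrite /= mul1r.
- by move=> a b f; apply: val_inj; rewrite /= mulr1.
- by move=> a b c g g' f; apply: val_inj; rewrite /= mulrDl.
- by move=> a b c g f f'; apply: val_inj; rewrite /= mulrDr.
Defined.

Definition is_Sq (i : nat) (n m : int) (f : rhom (r := ringoidA) n m) : Prop :=
  m = n + i%:Z /\ ssval f = Sq i.

Lemma is_Sq_exists (i : nat) (n : int) :
  exists f : rhom (r := ringoidA) n (n + i%:Z), is_Sq i f.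
Proof.
have h : shomog (n + i%:Z - n) (Sq i) by rewrite addrC addKr; exact: Sq_homog.
by exists (mkssub h).
Qed.

Definition unstable_rel : morset ringoidA := fun n m f =>
  exists2 i : nat, n < i%:Z & is_Sq i f.

Definition ringoidQ : ringoid := quot_ringoid (oigen unstable_rel).

Definition Qk_gen (k : nat) : morset ringoidQ := fun n m q =>
  exists i : nat, n - i%:Z < k%:Z /\
    exists2 f : rhom (r := ringoidA) n m, is_Sq i f & q = qproj _ f.

Definition ringoidQk (k : nat) : ringoid := sub_ringoid (sogen (Qk_gen k)).

(* Main.v *)
(* Index the operations from below: e_j = Sq^(n-j) : n -> 2n - j.  The generators
   of Q_k other than identities and zeros are the e_j with j < k and j < n, and
   the Adem relations read e_i e_j = sum of terms e_i' e_j' with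
   i' <= j < j' < i, for i > j.  Hence D^r M, the span of the images of the e_j
   with j < r, is a submodule of M.

   The key fact is that e_r is injective on P / D^r P when P is projective and
   r < k.  It reduces to P = Q_k(a, -), and there it is seen through the action
   on x_1 ... x_a in the polynomials whose exponents are powers of 2, where Sq^i
   doubles the exponents of the variables in a set of total degree i, summed over
   all such sets: for r <= a, D^r consists of the elements with no monomial
   having r or more exponents equal to 1, and e_r is injective modulo those.
   The action satisfies the Adem relations by the Bullett-Macdonald identities
   and a residue computation.

   For a projective resolution P of M, the sequences
   P / D^r -e_r-> P / D^r -> P / D^(r+1) -> 0 are then exact on the left too, so
   by induction on r the complex P / D^r is exact in positions s > r.  For r = k
   this says that Ext^s(M, S) = 0 for s > k and S concentrated in one degree;
   since every module is bounded below, the extension of a cocycle to P_(s-1)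
   can be built degree by degree. *)

Require Import Defs.
From mathcomp Require Import all_boot all_order all_algebra.
From mathcomp Require Import zify ring finmap boolp classical_sets.
From mathcomp.multinomials Require Import monalg.
(* Again, because finmap shadows [ssval]. *)
Import Defs.

Set Implicit Arguments.
Unset Strict Implicit.
Unset Printing Implicit Defensive.

Import Order.TTheory GRing.Theory Num.Theory.
Local Open Scope ring_scope.

(** * Binomial coefficients mod 2 and a residue computation *)

(** Lucas's theorem on the last binary digit, for an even upper index. *)
Lemma odd_bin_double n m :
  odd 'C(n.*2, m.*2) = odd 'C(n, m) /\ odd 'C(n.*2, m.*2.+1) = false.
Proof.
elim: n m => [|n IH] m; first by case: m.
have E0 j : odd 'C(n.*2.+1, j.*2) = odd 'C(n, j).
  case: j => [|j]; first by rewrite !bin0.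
  by rewrite doubleS binS oddD (IH j).2 -doubleS (IH j.+1).1 addbF.
have E1 j : odd 'C(n.*2.+1, j.*2.+1) = odd 'C(n, j).
  by rewrite binS oddD (IH j).1 (IH j).2.
rewrite doubleS; split; last by rewrite binS oddD E1 E0 addbb.
case: m => [|m]; first by rewrite !bin0.
by rewrite doubleS binS oddD -doubleS E1 E0 binS oddD.
Qed.

(** The binary digits of 2^M - 1 - d are complementary to those of d, so some digit 1 of d meets a
    digit 0 and Lucas's theorem gives an even coefficient. *)
Lemma odd_bin_compl M d :
  (0 < d < 2 ^ M)%N -> odd 'C(2 ^ M - 1 - d, d) = false.
Proof.
elim: M d => [|M IH] d; first by case: d.
move=> /andP[d0 dM]; have eM : (2 ^ M.+1 = (2 ^ M).*2)%N by rewrite expnS mul2n.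
rewrite eM in dM *; have [odd_d|even_d] := boolP (odd d).
  have -> : d = d./2.*2.+1 by rewrite -[LHS]odd_double_half odd_d.
  set e := d./2; have -> : ((2 ^ M).*2 - 1 - e.*2.+1 = (2 ^ M - 1 - e).*2)%N.
    by move: (2 ^ M)%N => x; lia.
  exact: (odd_bin_double _ _).2.
have ed : d = d./2.*2 by rewrite -[LHS]odd_double_half (negbTE even_d).
rewrite ed; rewrite ed double_gt0 in d0; rewrite ed ltn_double in dM.
move: d0 dM; set e := d./2 => d0 dM.
have -> : ((2 ^ M).*2 - 1 - e.*2 = (2 ^ M - 1 - e).*2.+1)%N.
  by move: (2 ^ M)%N dM => x; lia.
case: (e) d0 dM => // e' d0 dM.
rewrite doubleS binS oddD (odd_bin_double _ _).2 -doubleS (odd_bin_double _ _).1.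
by rewrite addbF; apply: IH; rewrite d0.
Qed.

Lemma natF2 n : (n%:R : 'F_2) = (odd n)%:R.
Proof.
rewrite -[n in LHS]odd_double_half natrD -muln2 natrM.
by rewrite (pchar_Zp (isT : (1 < 2)%N)) mulr0 addr0.
Qed.

Lemma coef_X1n (n i : nat) : ((1 + 'X : {poly 'F_2}) ^+ n)`_i = 'C(n, i)%:R.
Proof.
rewrite exprDn coef_sum.
under eq_bigr => j _ do rewrite expr1n mul1r coefMn coefXn.
have [lin|ltni] := ltnP i n.+1.
  rewrite (bigD1 (Ordinal lin)) //= eqxx big1 ?addr0 // => j.
  by rewrite -val_eqE /= eq_sym => /negbTE ->; rewrite mul0rn.
rewrite bin_small // big1 // => j _; case: eqP => [e|]; last by rewrite mul0rn.
by have := ltn_ord j; rewrite -e ltnNge ltni.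
Qed.

Lemma pchar_polyF2 : 2%N \in [pchar {poly 'F_2}].
Proof. by rewrite pchar_poly; exact: pchar_Fp. Qed.

Lemma X1_pow2 M : (1 + 'X : {poly 'F_2}) ^+ (2 ^ M) = 1 + 'X^(2 ^ M).
Proof.
rewrite exprDn_pchar ?expr1n // pnatX; apply/orP; left.
by rewrite pnatE //; exact: pchar_polyF2.
Qed.

(* Pairing with the residue of [p |-> p / (X (1 + X))^(a + 1)] at 0, where the
   power series [(1 + X)^-(a + 1)] is truncated to [(1 + X)^(2^a - a - 1)]. *)
Lemma residue_extraction (N : nat) (c : nat -> 'F_2) :
  \sum_(j < N.+1) c j *: ('X * (1 + 'X) : {poly 'F_2}) ^+ (N - j) =
  \sum_(j < N.+1) c j *: ((1 + 'X) ^+ (N - j) * 'X^(j.*2)) ->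
  forall a b, (0 < a)%N -> (a < b.*2)%N -> (a + b = N)%N ->
  c b = \sum_(j < a./2.+1) 'C(b - j - 1, a - j.*2)%:R * c j.
Proof.
move=> E a b a0 ab abN; pose r := ((1 + 'X : {poly 'F_2}) ^+ (2 ^ a - a - 1)).
have la : (a < 2 ^ a)%N by exact: ltn_expl.
have /(congr1 (fun p => (p * r)`_a)) := E.
rewrite !mulr_suml !coef_sum.
have bN : (b < N.+1)%N by lia.
(* On the left only j = b survives: for j < b the factor X^(N - j) exceeds degree a, and for j > b
   the coefficient is 'C(2^a - 1 - d, d) with d = j - b, which is even. *)
rewrite (bigD1 (Ordinal bN)) //= big1 ?addr0 => [|j].
  rewrite -scalerAl coefZ exprMn -mulrA -exprD -abN addnK coefXnM ltnn subnn.
  rewrite coef_X1n bin0 mulr1 => ->.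
  have lN : (a./2.+1 <= (a + b).+1)%N by lia.
  rewrite (big_ord_widen _ (fun j => 'C(b - j - 1, a - j.*2)%:R * c j) lN).
  rewrite [RHS]big_mkcond /=; apply: eq_bigr => j _.
  rewrite -scalerAl coefZ mulrC mulrAC -exprD; case: ifP => hj.
    (* The factor (1 + X)^(2^a) = 1 + X^(2^a) does not affect the coefficient of X^a, since a <
       2^a. *)
    have -> : (a + b - j + (2 ^ a - a - 1) = 2 ^ a + (b - j - 1))%N by lia.
    rewrite exprD X1_pow2 mulrDl mul1r mulrDl coefD coefMXn.
    have -> : (a < j.*2)%N = false by lia.
    by rewrite coef_X1n -mulrA ['X^(2 ^ a) * _]mulrC coefMXn la addr0 mulrC.
  have aj : (a < j.*2)%N by move/negbT: hj; rewrite -leqNgt; lia.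
  by rewrite coefMXn aj mul0r.
rewrite -val_eqE /= => jb; rewrite -scalerAl coefZ exprMn -mulrA -exprD coefXnM.
have jN := ltn_ord j; case: (ltnP a) => aNj; first by rewrite mulr0.
rewrite coef_X1n natF2; set d := (a - (N - j))%N.
have -> : (N - j + (2 ^ a - a - 1) = 2 ^ a - 1 - d)%N by rewrite /d; lia.
by rewrite odd_bin_compl ?mulr0 // /d; lia.
Qed.

(** * Steenrod operations on polynomials *)

(* [c : expo] stands for the monomial prod_l x_l^(2^(c l)), and a function
   [y : expo -> 'F_2] for its family of coefficients.  Accordingly [sqop i y c]
   collects the monomials that give c when the exponents in some U are doubled. *)
Section Monomials.
Variable a : nat.
Definition expo := {ffun 'I_a -> nat}.
Definition choice_of_vars := {ffun 'I_a -> bool}.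
Implicit Types (c : expo) (U W : choice_of_vars).

Definition mdegree c : nat := (\sum_l 2 ^ c l)%N.
Definition lower U c : expo := [ffun l => (c l - U l)%N].
Definition lowerable U c : bool := [forall l, U l ==> (0 < c l)%N].
(** The exponent is the one before doubling: doubling adds to the degree exactly what the doubled
    variables carried. *)
Definition lowdeg U c : nat := (\sum_(l | U l) 2 ^ (c l).-1)%N.

Definition sqop (i : nat) (y : expo -> 'F_2) c : 'F_2 :=
  \sum_(U | lowerable U c && (lowdeg U c == i)) y (lower U c).

Lemma mdegree_lower U c : lowerable U c ->
  mdegree c = (mdegree (lower U c) + lowdeg U c)%N.
Proof.
move=> /forallP cU; rewrite /mdegree /lowdeg [X in (_ + X)%N]big_mkcond -big_split.
apply: eq_bigr => l _; rewrite ffunE; have := cU l; case: (U l) => /= cl.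
  by case: (c l) cl => // n _; rewrite subn1 /= expnS mul2n -addnn.
by rewrite subn0 addn0.
Qed.

Lemma mdegree_lowdeg U c : lowerable U c ->
  mdegree (lower U c) = (lowdeg U c + \sum_(l | ~~ U l) 2 ^ c l)%N.
Proof.
move=> /forallP cU; rewrite /mdegree (bigID U) /=; congr (_ + _)%N;
  apply: eq_bigr => l Ul; rewrite ffunE; first by rewrite Ul subn1.
by rewrite (negbTE Ul) subn0.
Qed.

(** A variable with exponent 2^0 cannot result from a doubling, so it lies outside U and contributes
    1. *)
Lemma sum_zeros_le U c : lowerable U c ->
  (\sum_(l | c l == 0) 1 <= \sum_(l | ~~ U l) 2 ^ c l)%N.
Proof.
move=> /forallP cU; rewrite [leqRHS](bigID (fun l => c l == 0)) /=.
apply: leq_trans (leq_addr _ _).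
rewrite [leqLHS](eq_bigl (fun l => ~~ U l && (c l == 0))) => [|l].
  by apply: leq_sum => l _; rewrite expn_gt0.
by have := cU l; case: (U l) => //=; case: (c l).
Qed.
End Monomials.

(** * The total Steenrod operation and the Bullett-Macdonald identities *)

Section BullettMacdonald.
Variables (a : nat) (L : comNzRingType).
Hypothesis char2 : (2%:R : L) = 0.
Implicit Types (c : expo a) (y : expo a -> L) (u v : L).

Definition psq u y c : L :=
  \sum_(U | lowerable U c) u ^+ lowdeg U c * y (lower U c).

Definition weight u (n : nat) (b : bool) : L :=
  if b then (if (0 < n)%N then u ^+ (2 ^ n.-1) else 0) else 1.

(** The weights factor over the variables, which is the Cartan formula; a set that is not lowerable
    has weight 0 at some variable. *)
Lemma psq_weight u y c :
  psq u y c = \sum_(U : choice_of_vars a)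
    (\prod_l weight u (c l) (U l)) * y (lower U c).
Proof.
rewrite /psq big_mkcond; apply: eq_bigr => U _.
case: ifPn => [/forallP cU|/forallPn[l]].
  congr (_ * _); rewrite /lowdeg -prodrXr big_mkcond; apply: eq_bigr => l _.
  by rewrite /weight; have := cU l; case: (U l) => //= ->.
rewrite negb_imply => /andP[Ul cl]; rewrite (bigD1 l) //= /weight Ul (negbTE cl).
by rewrite !mul0r.
Qed.

(* The coefficient of x^(2^n) in P(u)P(v) applied to x^(2^(n - g)), where P(u) is
   the total operation sum_i u^i Sq^i. *)
Definition weight2 u v (n g : nat) : L :=
  \sum_(x : bool) \sum_(z : bool)
    ((x + z)%N == g)%:R * weight u n x * weight v (n - x)%N z.

(** Pairs of sets are grouped by how often each variable is doubled: 0, 1 or 2 times. *)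
Lemma psq_psq u v y c : psq u (psq v y) c =
  \sum_(g : {ffun 'I_a -> 'I_3})
     (\prod_l weight2 u v (c l) (g l)) * y [ffun l => (c l - g l)%N].
Proof.
have distr (g : {ffun 'I_a -> 'I_3}) : \prod_l weight2 u v (c l) (g l) =
    \sum_(U : choice_of_vars a) \sum_(W : choice_of_vars a)
      \prod_l (((U l + W l)%N == g l)%:R * weight u (c l) (U l)
               * weight v (c l - U l)%N (W l)).
  by rewrite bigA_distr_bigA; apply: eq_bigr => U _; rewrite bigA_distr_bigA.
under [RHS]eq_bigr => g _.
  rewrite distr mulr_suml; under eq_bigr => U _ do rewrite mulr_suml.
  over.
rewrite psq_weight exchange_big; apply: eq_bigr => U _ /=.
rewrite psq_weight mulr_sumr exchange_big; apply: eq_bigr => W _ /=.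
pose g0 : {ffun 'I_a -> 'I_3} := [ffun l => inord (U l + W l)].
have g0E l : g0 l = (U l + W l)%N :> nat.
  by rewrite ffunE inordK //; case: (U l); case: (W l).
rewrite (bigD1 g0) //= [X in _ + X]big1 ?addr0 => [|g gg0].
  rewrite mulrA -big_split; congr (_ * _) => /=.
    by apply: eq_bigr => l _; rewrite g0E eqxx mul1r ffunE.
  by congr y; apply/ffunP => l; rewrite [RHS]ffunE g0E !ffunE subnDA.
have [l gl] : exists l, g l != g0 l.
  apply/existsP; rewrite -negb_forall; apply: contra gg0 => /forallP E.
  by apply/eqP/ffunP => l; exact/eqP.
rewrite (bigD1 l) //=; have -> : ((U l + W l)%N == g l) = false.
  by rewrite -g0E eq_sym -[RHS](negbTE gl).
by rewrite !mul0r.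
Qed.

(* The Bullett-Macdonald identities. *)
Lemma psq_psq_symmetric u v u' v' y c :
  u + v = u' + v' -> u ^+ 2 * v = u' ^+ 2 * v' ->
  psq u (psq v y) c = psq u' (psq v' y) c.
Proof.
move=> e1 e2; rewrite !psq_psq; apply: eq_bigr => g _; congr (_ * _).
apply: eq_bigr => l _.
have pow2 (x x' : L) n : (x + x') ^+ (2 ^ n) = x ^+ (2 ^ n) + x' ^+ (2 ^ n).
  have p2 : 2%N \in [pchar L] by rewrite inE /= char2.
  by rewrite exprDn_pchar // pnatX pnatE ?p2.
(* Each local factor depends only on u + v and u^2 v: one doubling gives a power of the sum by
   additivity of Frobenius, and two doublings give a power of u^2 v. *)
suff W x x' n (i : 'I_3) : weight2 x x' n i =
    if i == 0 :> nat then 1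
    else if i == 1%N :> nat then (if (0 < n)%N then (x + x') ^+ (2 ^ n.-1) else 0)
    else (if (1 < n)%N then (x ^+ 2 * x') ^+ (2 ^ n.-2) else 0).
  by rewrite !W e1 e2.
rewrite /weight2 !big_bool /weight /= !subn0 !subn1.
case: i => -[|[|[|//]]] ilt /=; rewrite ?(mul0r, mul1r, mulr1, add0r, addr0) //.
  by case: n => [|n] /=; rewrite ?addr0 // pow2.
case: n => [|[|n]] /=; rewrite ?(mul0r, mulr0) //.
by rewrite exprMn -exprM -expnS.
Qed.
End BullettMacdonald.

(** * The Adem relations for the operations on polynomials *)

Section Adem.
Variable a : nat.
Implicit Types (c : expo a) (y : expo a -> 'F_2).

Lemma lowdeg_le (U : choice_of_vars a) c : lowerable U c -> (lowdeg U c <= mdegree c)%N.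
Proof. by move=> /mdegree_lower ->; rewrite leq_addl. Qed.

Lemma psq_sqop (u : {poly 'F_2}) y c B : (mdegree c <= B)%N ->
  psq u (fun d => (y d)%:P) c = \sum_(i < B.+1) u ^+ i * (sqop i y c)%:P.
Proof.
move=> cB; rewrite /psq (partition_big (fun U => inord (lowdeg U c) : 'I_B.+1) xpredT) //=.
apply: eq_bigr => i _; rewrite /sqop raddf_sum mulr_sumr /=.
apply: eq_big => U; last first.
  move=> /andP[cU /eqP <-]; rewrite inordK // ltnS.
  exact: leq_trans (lowdeg_le cU) cB.
case cU: (lowerable U c) => //=; rewrite -val_eqE /= inordK //.
by rewrite ltnS; exact: leq_trans (lowdeg_le cU) cB.
Qed.

Lemma psq_sqop2 (u v : {poly 'F_2}) y c B : (mdegree c <= B)%N ->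
  psq u (psq v (fun d => (y d)%:P)) c =
  \sum_(j < B.+1) \sum_(i < B.+1) u ^+ i * v ^+ j * (sqop i (sqop j y) c)%:P.
Proof.
move=> cB; transitivity (\sum_(j < B.+1) v ^+ j * psq u (fun d => (sqop j y d)%:P) c).
  under [RHS]eq_bigr => j _ do rewrite /psq mulr_sumr.
  rewrite [RHS]exchange_big {1}/psq; apply: eq_bigr => U cU /=.
  rewrite (psq_sqop _ _ (B := B)) ?mulr_sumr.
    by apply: eq_bigr => j _; rewrite mulrCA.
  by apply: leq_trans cB; rewrite (mdegree_lower cU) leq_addr.
apply: eq_bigr => j _; rewrite (psq_sqop _ _ cB) mulr_sumr.
by apply: eq_bigr => i _; rewrite mulrCA mulrA.
Qed.

Lemma sqop_ext i y y' c : y =1 y' -> sqop i y c = sqop i y' c.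
Proof. by move=> e; apply: eq_bigr => U _; rewrite e. Qed.

(** The two operations raise the degree by i + j, so restricting [y] to one degree isolates the
    terms of total degree N. *)
Lemma sqop_cut (N i j : nat) y c :
  sqop i (sqop j (fun d => if (mdegree d + N == mdegree c)%N then y d else 0)) c =
  if (i + j == N)%N then sqop i (sqop j y) c else 0.
Proof.
have dE (U W : choice_of_vars a) : lowerable U c && (lowdeg U c == i) ->
    lowerable W (lower U c) && (lowdeg W (lower U c) == j) ->
    (mdegree (lower W (lower U c)) + N == mdegree c)%N = (i + j == N)%N.
  move=> /andP[cU /eqP <-] /andP[cW /eqP <-].
  by rewrite (mdegree_lower cU) (mdegree_lower cW); lia.
case: ifP => ijN; last first.
  by apply: big1 => U cU; apply: big1 => W cW; rewrite (dE U W) // ijN.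
by apply: eq_bigr => U cU; apply: eq_bigr => W cW; rewrite (dE U W) // ijN.
Qed.

Lemma sqop_adem (p q : nat) y c : (0 < p)%N -> (p < q.*2)%N ->
  sqop p (sqop q y) c =
  \sum_(j < p./2.+1) 'C(q - j - 1, p - j.*2)%:R * sqop (p + q - j) (sqop j y) c.
Proof.
move=> p0 pq; set N := (p + q)%N.
pose z := fun d => if (mdegree d + N == mdegree c)%N then y d else 0.
pose C j := sqop (N - j) (sqop j y) c.
have expand (u v : {poly 'F_2}) : psq u (psq v (fun d => (z d)%:P)) c =
    \sum_(j < N.+1) C j *: (u ^+ (N - j) * v ^+ j).
  pose B := (mdegree c + N)%N.
  rewrite (psq_sqop2 _ _ _ (leq_addr N _)) -/B.
  have NB : (N.+1 <= B.+1)%N by rewrite ltnS leq_addl.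
  rewrite (big_ord_widen _ (fun j => C j *: (u ^+ (N - j) * v ^+ j)) NB).
  rewrite [RHS]big_mkcond; apply: eq_bigr => j _ /=.
  case: ifP => jN; last first.
    apply: big1 => i _; rewrite sqop_cut; have -> : (i + j == N)%N = false by lia.
    by rewrite mulr0.
  have iB : (N - j < B.+1)%N by rewrite ltnS; lia.
  rewrite (bigD1 (Ordinal iB)) //= big1 ?addr0 => [|i].
    rewrite sqop_cut subnK; last by rewrite -ltnS.
    by rewrite eqxx mulrC mul_polyC.
  rewrite -val_eqE /= => ij; rewrite sqop_cut.
  have -> : (i + j == N)%N = false by lia.
  by rewrite mulr0.
have char2 : (2%:R : {poly 'F_2}) = 0 by rewrite -polyC_natr (pchar_Zp (isT : (1 < 2)%N)).
(* Here u + v = 1 + X + X^2 = u' + v' and u^2 v = X^2 (1 + X)^2 = u'^2 v'; the expansions of the two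
   sides are those compared in [residue_extraction]. *)
have := psq_psq_symmetric char2 (fun d => (z d)%:P) c
  (u := 'X * (1 + 'X)) (v := 1) (u' := 1 + 'X) (v' := 'X ^+ 2).
rewrite !expand => E.
have <- : (N - q = p)%N by rewrite addnK.
rewrite -[LHS]/(C q) (residue_extraction (N := N) _ p0 pq) ?addnK //.
under eq_bigr => j _ do rewrite -[_ ^+ (N - j)]mulr1 -{2}(expr1n _ j).
rewrite E; first by apply: eq_bigr => j _; rewrite -exprM mul2n.
  by ring.
by rewrite mulr1 exprMn mulrC.
Qed.
End Adem.

(** * Instability, and detection by the number of exponents equal to 1 *)

Section SqopFacts.
Variable a : nat.
Implicit Types (c : expo a) (y : expo a -> 'F_2).

(** Exponents are stored as logarithms, so these are the variables with exponent 1. *)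
Definition zeros c : nat := #|[pred l | c l == 0%N]|.

Definition supported (n : int) y := forall c, y c != 0 -> (mdegree c)%:Z = n.

Lemma sqop_lin (I : Type) (r : seq I) (k : I -> 'F_2) (Y : I -> expo a -> 'F_2) i c :
  sqop i (fun d => \sum_(j <- r) k j * Y j d) c = \sum_(j <- r) k j * sqop i (Y j) c.
Proof.
rewrite /sqop; under [RHS]eq_bigr => j _ do rewrite mulr_sumr.
by rewrite [RHS]exchange_big.
Qed.

Lemma sqop_neq0 i y c : sqop i y c != 0 ->
  exists U : choice_of_vars a, [/\ lowerable U c, lowdeg U c = i & y (lower U c) != 0].
Proof.
move=> yc; apply/not_existsP => H; case/eqP: yc; apply: big1 => U /andP[cU /eqP e].
by apply/eqP; apply: contrapT => /negP yU; exact: (H U).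
Qed.

Lemma sqop_supported n i y : supported n y -> supported (n + i%:Z) (sqop i y).
Proof.
move=> yn c /sqop_neq0[U [cU <- /yn <-]].
by rewrite (mdegree_lower cU) PoszD.
Qed.

Lemma sqop_unstable n i y c : supported n y -> n < i%:Z -> sqop i y c = 0.
Proof.
move=> yn ni; apply/eqP; apply: contraTT ni => /sqop_neq0[U [cU <- /yn <-]].
by rewrite mdegree_lowdeg // -leNgt lez_nat leq_addr.
Qed.

Lemma sqop0 y c : sqop 0 y c = y c.
Proof.
pose U0 : choice_of_vars a := [ffun=> false].
have lU0 : lower U0 c = c by apply/ffunP => l; rewrite !ffunE subn0.
rewrite /sqop (big_pred1 U0) ?lU0 // => U; apply/andP/eqP => [[cU U0E]|->].
  apply/ffunP => l; rewrite ffunE; apply/negP => Ul; move: U0E.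
  by rewrite /lowdeg (bigD1 l) //= addn_eq0 expn_eq0.
split; first by apply/forallP => l; rewrite ffunE.
by rewrite /lowdeg big_pred0 // => l; rewrite ffunE.
Qed.

Lemma zeros_le (U : choice_of_vars a) c : lowerable U c ->
  (zeros c <= \sum_(l | ~~ U l) 2 ^ c l)%N.
Proof. by move=> cU; rewrite /zeros -sum1_card; exact: sum_zeros_le. Qed.

(** In a monomial of e_j y the variables that were not doubled have total degree j, and every
    variable with exponent 1 is among them. *)
Lemma sqop_zeros n i j y c : supported n y -> n = (i + j)%N%:Z ->
  (j < zeros c)%N -> sqop i y c = 0.
Proof.
move=> yn nij jc; apply/eqP; apply: contraTT jc => /sqop_neq0[U [cU Ui /yn]].
rewrite mdegree_lowdeg // nij Ui => -[/addnI <-].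
by rewrite -leqNgt zeros_le.
Qed.

(** This is the source of the injectivity of e_r. Keep r variables of exponent 1 in c and double all
    others: the resulting monomial d has exactly r exponents 1, and its coefficient in e_r y is
    [y c]. *)
Lemma sqop_zeros_inj n i r y : supported n y -> n = (i + r)%N%:Z ->
  (forall c, zeros c = r -> sqop i y c = 0) ->
  forall c, (r <= zeros c)%N -> y c = 0.
Proof.
move=> yn nir H c rc; apply/eqP; apply: contraT => yc.
have [R /andP[RZ /eqP Rr]] : exists R : {set 'I_a},
    (R \subset [set l | c l == 0%N]) && (#|R| == r).
  have Zc : #|[set l | c l == 0%N]| = zeros c by apply: eq_card => l; rewrite inE.
  exists [set l in take r (enum [set l | c l == 0%N])]; apply/andP; split.
    by apply/fintype.subsetP => l; rewrite inE => /mem_take; rewrite mem_enum.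
  rewrite cardsE (card_uniqP _) ?take_uniq ?enum_uniq // size_take.
  by rewrite -cardE Zc; case: ltnP => // zr; rewrite eqn_leq zr rc.
pose U0 : choice_of_vars a := [ffun l => l \notin R].
pose d : expo a := [ffun l => (c l + U0 l)%N].
have dR l : l \in R -> d l = 0%N.
  move=> lR; rewrite !ffunE lR addn0.
  by have := fintype.subsetP RZ l lR; rewrite inE => /eqP.
have dR' l : l \notin R -> (0 < d l)%N by move=> lR; rewrite !ffunE lR addn1.
have dU0 : lowerable U0 d.
  by apply/forallP => l; rewrite [U0 l]ffunE; apply/implyP => /dR'.
have lU0 : lower U0 d = c by apply/ffunP => l; rewrite ffunE [d l]ffunE addnK.
have zd : zeros d = r.
  rewrite -Rr; apply: eq_card => l; rewrite !inE.
  by have [/dR ->|/dR'] := boolP (l \in R) => //; case: (d l).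
have sumR (U : choice_of_vars a) : lowerable U d ->
    (\sum_(l | ~~ U l) 2 ^ d l = r + \sum_(l | ~~ U l && (l \notin R)) 2 ^ d l)%N.
  move=> /forallP dU; rewrite (bigID (mem R)) /=; congr (_ + _)%N.
  rewrite -Rr -sum1_card; apply: eq_big => l.
    case lR: (l \in R); rewrite ?andbF ?andbT //.
    by have := dU l; rewrite dR // implybF.
  by case/andP => _ /dR ->.
have := H d zd; rewrite /sqop (bigD1 U0) /=; last first.
  rewrite dU0 /=; have := yn _ yc; rewrite nir => -[].
  have := mdegree_lowdeg dU0; rewrite lU0 => -> .
  rewrite sumR // big_pred0 ?addn0 => [/addIn -> //|l].
  by rewrite ffunE; case: (l \in R).
rewrite lU0 big1 ?addr0 => [e|U /andP[/andP[dU /eqP dUi] UU0]].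
  by rewrite e eqxx in yc.
(* A contributing U omits R, where d has exponent 1. The omitted variables have total degree n - i =
   r, which R already exhausts, so U is [U0]. *)
apply/eqP; apply: contraT => /yn; rewrite nir mdegree_lowdeg // dUi => -[/addnI].
rewrite sumR // => e; case/eqP: UU0; apply/ffunP => l; rewrite ffunE.
have [lR|lR] := boolP (l \in R).
  by apply/negbTE; have /forallP/(_ l) := dU; rewrite dR // implybF.
apply: contraT => Ul; move: e; rewrite (bigD1 l) ?Ul //= => e.
have : (0 < 2 ^ d l)%N by rewrite expn_gt0.
lia.
Qed.
End SqopFacts.

(** * The action of the Steenrod algebra *)

Section RprojAdditive.
Variables (R : pzRingType) (I : rideal R).

Lemma rproj0 : rproj I 0 = 0.
Proof. by rewrite -[0 in LHS](subrr 0) rprojB subrr. Qed.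

Lemma rprojMn x n : rproj I (x *+ n) = rproj I x *+ n.
Proof. by elim: n => [|n IH]; rewrite ?rproj0 // !mulrS rprojD IH. Qed.

Lemma rproj_sum (J : Type) (r : seq J) (P : pred J) (F : J -> R) :
  rproj I (\sum_(j <- r | P j) F j) = \sum_(j <- r | P j) rproj I (F j).
Proof. exact: (big_morph _ (@rprojD _ I) rproj0). Qed.
End RprojAdditive.

Lemma Sq0 : Sq 0 = 1.
Proof.
apply/qproj_eq => I SI; rewrite -[_ - _]/(fsq 0 - 1); apply: SI.
exact: rel_sq0.
Qed.

Lemma Sq_adem (p q : nat) : (0 < p)%N -> (p < q.*2)%N ->
  Sq p * Sq q =
  \sum_(j < p./2.+1) (Sq (p + q - j)%N * Sq j) *+ 'C(q - j - 1, p - j.*2).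
Proof.
move=> p0 pq; rewrite /Sq -rprojM.
transitivity (rproj (rigen steenrod_rel) (\sum_(j < p./2.+1)
    (fsq (p + q - j)%N * fsq j) *+ 'C(q - j - 1, p - j.*2))).
  by apply/qproj_eq => I SI; apply: SI; exact: rel_adem.
by rewrite rproj_sum; apply: eq_bigr => j _; rewrite rprojMn rprojM.
Qed.

Section Action.
Variable a : nat.
Implicit Types (c : expo a) (y : expo a -> 'F_2).

Definition word_act (w : {fmonom nat}) y : expo a -> 'F_2 :=
  foldr (@sqop a) y (w : seq nat).

Definition free_act (x : freealg) y c : 'F_2 :=
  \sum_(w <- msupp x) x@_w * word_act w y c.

Lemma free_act_mmap x y c : free_act x y c = mmap idfun (fun w => word_act w y c) x.
Proof. by []. Qed.

Lemma free_actD x x' y c : free_act (x + x') y c = free_act x y c + free_act x' y c.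
Proof. by rewrite !free_act_mmap mmapD. Qed.

Lemma free_actB x x' y c : free_act (x - x') y c = free_act x y c - free_act x' y c.
Proof. by rewrite !free_act_mmap mmapB. Qed.

Lemma free_act0 y c : free_act 0 y c = 0.
Proof. by rewrite !free_act_mmap mmap0. Qed.

Lemma free_actMn x n y c : free_act (x *+ n) y c = free_act x y c *+ n.
Proof. by rewrite !free_act_mmap mmapMn. Qed.

Lemma free_act_sum (I : Type) (r : seq I) (X : I -> freealg) y c :
  free_act (\sum_(i <- r) X i) y c = \sum_(i <- r) free_act (X i) y c.
Proof.
exact: (big_morph (fun x => free_act x y c)
  (fun x x' => free_actD x x' y c) (free_act0 y c)).
Qed.

Lemma free_actU k w y c : free_act << k *g w >> y c = k * word_act w y c.
Proof. by rewrite free_act_mmap mmapU. Qed.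

Lemma free_act_fsq i y c : free_act (fsq i) y c = sqop i y c.
Proof. by rewrite free_actU mul1r /word_act fmU. Qed.

Lemma free_act1 y c : free_act 1 y c = y c.
Proof. by rewrite -[1]/(<< 1 *g _ >> : freealg) free_actU mul1r /word_act fm1. Qed.

Lemma word_act_lin (I : Type) (r : seq I) (k : I -> 'F_2) (Y : I -> expo a -> 'F_2) w c :
  word_act w (fun d => \sum_(j <- r) k j * Y j d) c = \sum_(j <- r) k j * word_act w (Y j) c.
Proof.
rewrite /word_act; elim: (w : seq nat) c => //= i s IH c.
by rewrite -sqop_lin; apply: sqop_ext => d; exact: IH.
Qed.

Lemma free_actM x x' y c : free_act (x * x') y c = free_act x (free_act x' y) c.
Proof.
rewrite malgME free_act_sum; apply: eq_bigr => v _; rewrite free_act_sum.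
rewrite word_act_lin mulr_sumr; apply: eq_bigr => w _.
by rewrite free_actU -mulrA /word_act fmM foldr_cat.
Qed.

Lemma word_act_eq0 w y c : (forall d, y d = 0) -> word_act w y c = 0.
Proof.
move=> y0; rewrite /word_act; elim: (w : seq nat) c => //= i s IH c.
by apply: big1 => U _; exact: IH.
Qed.

Definition annihilator_sg : sgroup freealg.
Proof.
exists (fun x => forall y c, free_act x y c = 0) => [y c|x x' hx hx' y c].
  exact: free_act0.
by rewrite free_actB hx hx' subr0.
Defined.

Definition annihilator : rideal freealg.
Proof.
exists annihilator_sg => r x hx y c; rewrite free_actM //.
by apply: big1 => w _; rewrite word_act_eq0 ?mulr0.
Defined.

Lemma steenrod_rel_annihilates x : steenrod_rel x -> annihilator x.
Proof.
case=> [|p q p0 pq] y c; first by rewrite free_actB free_act1 free_act_fsq sqop0 subrr.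
rewrite free_actB free_actM free_act_sum free_act_fsq.
rewrite (@sqop_ext _ p _ (sqop q y)) => [|d]; last exact: free_act_fsq.
rewrite sqop_adem //; apply/eqP; rewrite subr_eq0; apply/eqP.
apply: eq_bigr => j _; rewrite free_actMn free_actM free_act_fsq mulr_natl.
by congr (_ *+ _); apply: sqop_ext => d; rewrite free_act_fsq.
Qed.

Definition steenrod_act (s : steenrod) y c : 'F_2 := free_act (repr s) y c.

(** The chosen representative is immaterial, because the ideal of relations lies in
    [annihilator]. *)
Lemma steenrod_actE x y c : steenrod_act (rproj _ x) y c = free_act x y c.
Proof.
have : rigen steenrod_rel (repr (rproj (rigen steenrod_rel) x) - x).
  by apply/qproj_eq; rewrite /qproj reprK.
move=> /(_ annihilator steenrod_rel_annihilates y c)/eqP.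
by rewrite free_actB subr_eq0 => /eqP.
Qed.

Lemma steenrod_actB s s' y c :
  steenrod_act (s - s') y c = steenrod_act s y c - steenrod_act s' y c.
Proof.
have [x ->] := rproj_surj s; have [x' ->] := rproj_surj s'.
by rewrite -rprojB !steenrod_actE free_actB.
Qed.

Lemma steenrod_actM s s' y c :
  steenrod_act (s * s') y c = steenrod_act s (steenrod_act s' y) c.
Proof.
have [x ->] := rproj_surj s; have [x' ->] := rproj_surj s'.
rewrite -rprojM !steenrod_actE free_actM /free_act; apply: eq_bigr => w _; congr (_ * _).
by congr (word_act w _ c); apply/funext => d; rewrite -[LHS]/(free_act x' y d) steenrod_actE.
Qed.

Lemma steenrod_act_Sq i y c : steenrod_act (Sq i) y c = sqop i y c.
Proof. by rewrite steenrod_actE free_act_fsq. Qed.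

Lemma steenrod_act1 y c : steenrod_act 1 y c = y c.
Proof. by rewrite steenrod_actE free_act1. Qed.

Lemma steenrod_act_eq0 s y c : (forall d, y d = 0) -> steenrod_act s y c = 0.
Proof. by move=> y0; apply: big1 => w _; rewrite word_act_eq0 ?mulr0. Qed.

Lemma word_act_supported w n y : supported n y ->
  supported (n + (wdeg w)%:Z) (word_act w y).
Proof.
move=> yn; rewrite /word_act /wdeg; elim: (w : seq nat) => /= [|i s IH].
  by rewrite addr0.
by rewrite addnC PoszD addrA; exact: sqop_supported.
Qed.

Lemma steenrod_act_supported (m n : int) s y :
  shomog (m - n) s -> supported n y -> supported m (steenrod_act s y).
Proof.
move=> [x hx ->] yn c; rewrite steenrod_actE; apply: contra_neq_eq => cm.
rewrite /free_act big_seq big1 // => w wx; apply/eqP; rewrite mulf_eq0; apply/orP; right.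
apply: contraT => /(word_act_supported yn); rewrite (hx _ wx) addrC subrK => e.
by rewrite e eqxx in cm.
Qed.
End Action.

(** * The Steenrod algebra in degrees at most 0 *)

Lemma shomog_neg n s : n < 0 -> shomog n s -> s = 0.
Proof.
move=> n0 [x hx ->]; suff -> : x = 0 by exact: rproj0.
apply/eqP; rewrite -msupp_eq0; apply: contraT => /fset0Pn[w /hx e].
by rewrite -e in n0.
Qed.

Lemma steenrod_char2 : (1 + 1 : steenrod) = 0.
Proof.
have -> : (1 + 1 : steenrod) = rproj _ (1 + 1) by rewrite rprojD.
have -> : (1 + 1 : freealg) = 0; last exact: rproj0.
rewrite -[1]/(<< 1 *g _ >> : freealg) -monalgUD.
by rewrite -[1 + 1]/(2%:R) (pchar_Zp (isT : (1 < 2)%N)) monalgU0.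
Qed.

(** A word of degree 0 has only letters 0, and Sq^0 = 1, so this part is generated additively by 1,
    where 1 + 1 = 0. *)
Lemma shomog0 s : shomog 0 s -> s = 0 \/ s = 1.
Proof.
move=> [x hx ->]; rewrite [x]monalgE rproj_sum big_seq.
apply: (big_ind (fun s : steenrod => s = 0 \/ s = 1)); first by left.
  move=> u v [->|->] [->|->]; rewrite ?addr0 ?add0r; [by left|by right|by right|].
  by left; exact: steenrod_char2.
move=> w /hx[] w0; have [-> | ->] : x@_w = 0 \/ x@_w = 1.
- by case: (x@_w) => -[|[|//]] i; [left|right]; apply: val_inj.
- by left; rewrite monalgU0; exact: rproj0.
right; have : all (pred1 0%N) (w : seq nat).
  by apply/allP => i iw; rewrite /= -leqn0 -w0 /wdeg sumnE (big_rem i) //= leq_addr.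
have -> : w = FMonom (w : seq nat) by rewrite fmK.
elim: (w : seq nat) => [_|i l IH /= /andP[/eqP -> /IH]] /=.
  by rewrite -fmoneE; apply/qproj_eq; rewrite subrr; exact: sg0.
have -> : << 1 *g FMonom (0 :: l) >> = fsq 0 * << 1 *g FMonom l >> :> freealg.
  by rewrite /fsq malgM_def fgmulUU mulr1 fmuE -[mmul _ _]/(fmmul _ _) fmmulE.
by rewrite rprojM => ->; rewrite mulr1 -Sq0.
Qed.

(** * Decomposables of Q_k-modules *)

Lemma subr_addr (V : zmodType) (u v w : V) : u - v - - w = u - (v - w).
Proof. by rewrite opprK opprB addrA addrAC. Qed.

Lemma subr_subr (V : zmodType) (u v w z : V) :
  u - v - (w - z) = (u - w) - (v - z).
Proof. by rewrite !opprB [z - w]addrC addrACA [- v + z]addrC. Qed.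

Lemma mact0l (R : ringoid) (M : lmodule R) (a b : R) (x : M a) :
  mact M (0 : rhom a b) x = 0.
Proof. by apply: (@addrI _ (mact M 0 x)); rewrite -mactDl !addr0. Qed.

Lemma mactNl (R : ringoid) (M : lmodule R) (a b : R) (f : rhom a b) (x : M a) :
  mact M (- f) x = - mact M f x.
Proof. by apply/eqP; rewrite -addr_eq0 -mactDl addNr mact0l. Qed.

Section Qk.
Variable k : nat.
Notation Q := (ringoidQk k).
Implicit Types (n m p : int).

(** Morphisms of Q_k are handled through lifts to the Steenrod algebra, which are determined only up
    to the instability ideal. *)
Definition represents n m (q : rhom (r := Q) n m) (s : steenrod) : Prop :=
  exists f : rhom (r := ringoidA) n m,
    ssval f = s /\ ssval q = qproj (oigen unstable_rel n m) f.

Lemma represents_inj n m (q q' : rhom (r := Q) n m) s :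
  represents q s -> represents q' s -> q = q'.
Proof.
move=> [f [fs qf]] [f' [fs' qf']]; apply: val_inj; rewrite /= qf qf'.
by congr (qproj _ _); apply: val_inj; rewrite /= fs fs'.
Qed.

Lemma represents_exists n m (q : rhom (r := Q) n m) : exists s, represents q s.
Proof.
by have [f qf] := qproj_surj (ssval q); exists (ssval f); exists f.
Qed.

Lemma represents_homog n m (q : rhom (r := Q) n m) s :
  represents q s -> shomog (m - n) s.
Proof. by move=> [f [<- _]]; exact: ssubP f. Qed.

Lemma represents_sub n m (q q' : rhom (r := Q) n m) s s' :
  represents q s -> represents q' s' -> represents (q - q') (s - s').
Proof.
move=> [f [fs qf]] [f' [fs' qf']]; exists (f - f'); split; first by rewrite -fs -fs'.
by rewrite qprojB -qf -qf'.
Qed.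

Lemma represents0 n m : represents (0 : rhom (r := Q) n m) 0.
Proof.
have [s qs] := represents_exists (0 : rhom (r := Q) n m).
by have := represents_sub qs qs; rewrite !subrr.
Qed.

Lemma represents_add n m (q q' : rhom (r := Q) n m) s s' :
  represents q s -> represents q' s' -> represents (q + q') (s + s').
Proof.
move=> qs qs'; rewrite -[q']opprK -[s']opprK; apply: represents_sub => //.
by rewrite -sub0r -[- s']sub0r; apply: represents_sub => //; exact: represents0.
Qed.

Lemma represents_id n : represents (rid (r := Q) n) 1.
Proof. by exists (rid (r := ringoidA) n). Qed.

Lemma represents_comp n m p (q' : rhom (r := Q) m p) (q : rhom (r := Q) n m) s' s :
  represents q' s' -> represents q s -> represents (rcomp q' q) (s' * s).
Proof.
move=> [f' [fs' qf']] [f [fs qf]]; exists (rcomp f' f).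
split; first by rewrite /= fs fs'.
by rewrite /= qf qf' qcompE.
Qed.

Lemma represents_Sq_exists (i : nat) n m : m = n + i%:Z -> n - i%:Z < k%:Z ->
  exists q : rhom (r := Q) n m, represents q (Sq i).
Proof.
move=> -> ni; have [f fi] := is_Sq_exists i n.
have qk : sogen (@Qk_gen k) n (n + i%:Z) (qproj (oigen unstable_rel _ _) f).
  by move=> T; apply; exists i; split=> //; exists f.
by exists (mkssub qk); exists f; case: fi.
Qed.

Lemma represents_unstable (i : nat) n m (q : rhom (r := Q) n m) :
  represents q (Sq i) -> m = n + i%:Z -> n < i%:Z -> q = 0.
Proof.
move=> [f [fs qf]] mn ni; apply: val_inj; rewrite /= qf.
have -> : 0 = qproj (oigen unstable_rel n m) 0.
  by rewrite -[0 in RHS](subrr 0) qprojB subrr.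
apply/qproj_eq; rewrite subr0 => I; apply; exists i => //.
Qed.

Lemma hom_neg n m (q : rhom (r := Q) n m) : m < n -> q = 0.
Proof.
move=> mn; have [s qs] := represents_exists q.
have s0 : s = 0 by apply: shomog_neg (represents_homog qs); rewrite subr_lt0.
by rewrite s0 in qs; exact: represents_inj qs (represents0 _ _).
Qed.

Lemma hom_id n (q : rhom (r := Q) n n) : q = 0 \/ q = rid (r := Q) n.
Proof.
have [s qs] := represents_exists q.
have := represents_homog qs; rewrite subrr => /shomog0[s0|s1]; rewrite ?s0 ?s1 in qs.
  by left; exact: represents_inj qs (represents0 _ _).
by right; exact: represents_inj qs (represents_id _).
Qed.

Lemma rid_neg n : n < 0 -> (rid (r := Q) n) = 0.
Proof.
move=> n0; have := represents_id n; rewrite -Sq0.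
by move=> /represents_unstable; apply; rewrite ?addr0.
Qed.

(* q is e_j = Sq^(n-j), with n > j so that it is neither zero nor the identity
   by instability. *)
Definition low (j : nat) n m (q : rhom (r := Q) n m) : Prop :=
  exists i : nat, [/\ (0 < i)%N, n = (i + j)%N%:Z, m = n + i%:Z & represents q (Sq i)].

Lemma low_inj j n m (q q' : rhom (r := Q) n m) : low j q -> low j q' -> q = q'.
Proof.
move=> [i [_ ni _ qi]] [i' [_ ni' _ qi']]; apply: represents_inj qi _.
have -> : i = i' by move: ni'; rewrite ni => -[/addIn].
by [].
Qed.

Lemma low_source j n n' m (q : rhom (r := Q) n m) (q' : rhom (r := Q) n' m) :
  low j q -> low j q' -> n = n'.
Proof. by move=> [i [_ ni mi _]] [i' [_ ni' mi' _]]; lia. Qed.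

Lemma hom_ind (P : forall n m, rhom (r := Q) n m -> Prop) :
  (forall n m, P n m 0) ->
  (forall n m q q', P n m q -> P n m q' -> P n m (q - q')) ->
  (forall n, P n n (rid (r := Q) n)) ->
  (forall n m p (q' : rhom (r := Q) m p) (q : rhom (r := Q) n m),
     P m p q' -> P n m q -> P n p (rcomp q' q)) ->
  (forall i n m (q : rhom (r := Q) n m), m = n + i%:Z -> n - i%:Z < k%:Z ->
     represents q (Sq i) -> P n m q) ->
  forall n m q, P n m q.
Proof.
move=> P0 PB P1 PM Pgen.
(* The generated subringoid is taken inside Q, so [P] is first transported to morphisms of Q,
   together with membership in Q_k. *)
pose mem n m (f : rhom (r := ringoidQ) n m) :=
  exists2 q : rhom (r := Q) n m, ssval q = f & P n m q.
have m0 n m : mem n m 0 by exists 0.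
have mB n m f f' : mem n m f -> mem n m f' -> mem n m (f - f').
  by move=> [q <- Pq] [q' <- Pq']; exists (q - q') => //; exact: PB.
have m1 n : mem n n (rid (r := ringoidQ) n) by exists (rid (r := Q) n).
have mM n m p (f' : rhom (r := ringoidQ) m p) (f : rhom (r := ringoidQ) n m) :
    mem m p f' -> mem n m f -> mem n p (rcomp f' f).
  by move=> [q' <- Pq'] [q <- Pq]; exists (rcomp q' q) => //; exact: PM.
pose T := @SubRingoid ringoidQ (fun n m => SGroup (m0 n m) (mB n m)) m1 mM.
move=> n m q; have [|q' qq' Pq'] := ssubP q T; last by have <- : q' = q by exact: val_inj.
move=> {q} {}n {}m _ [i [ni [f fi ->]]]; have [mn fs] := fi.
have [q' q'i] := represents_Sq_exists mn ni.
exists q'; last exact: Pgen mn ni q'i.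
have [f' [fs' ->]] := q'i; congr (qproj _ _); apply: val_inj.
by rewrite /= fs fs'.
Qed.


Section Decomposables.
Variable M : lmodule Q.

(* D^r M of the header. *)
Definition dec_mem (r : nat) m (x : M m) : Prop :=
  forall G : sgroup (M m),
    (forall j n (q : rhom (r := Q) n m) (y : M n), (j < r)%N -> low j q ->
       G (mact M q y)) -> G x.

Definition dec (r : nat) m : sgroup (M m).
Proof.
exists (@dec_mem r m) => [G _|x y hx hy G HG]; first exact: sg0.
by apply: sgB; [exact: hx | exact: hy].
Defined.

Lemma dec_low r j n m (q : rhom (r := Q) n m) (y : M n) : (j < r)%N -> low j q ->
  dec r m (mact M q y).
Proof. by move=> jr qj G; apply; eassumption. Qed.

Lemma dec_le r r' m (x : M m) : (r <= r')%N -> dec r m x -> dec r' m x.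
Proof.
by move=> rr'; apply=> j n q y jr; apply: dec_low; exact: leq_trans jr rr'.
Qed.

Lemma dec0 m (x : M m) : dec 0 m x -> x = 0.
Proof.
have zB (u v : M m) : u = 0 -> v = 0 -> u - v = 0 by move=> -> ->; rewrite subrr.
pose Z := @SGroup (M m) (fun x => x = 0) erefl zB.
by move=> /(_ Z); apply.
Qed.


(** At most one e_r has target m, since m = 2n - r determines n; its image is therefore already a
    subgroup. The first alternative covers the case where no e_r ends in m. *)
Lemma decS r m (x : M m) : dec r.+1 m x ->
  dec r m x \/ exists n (q : rhom (r := Q) n m) (z : M n),
    low r q /\ dec r m (x - mact M q z).
Proof.
pose mem (x : M m) := dec r m x \/ exists n (q : rhom (r := Q) n m) (z : M n),
    low r q /\ dec r m (x - mact M q z).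
have mem0 : mem 0 by left; exact: sg0.
have memB u v : mem u -> mem v -> mem (u - v).
  case=> [hu|[n [q [z [qr hu]]]]]; case=> [hv|[n' [q' [z' [q'r hv]]]]].
  - by left; exact: sgB.
  - right; exists n', q', (- z'); split=> //.
    have -> : u - v - mact M q' (- z') = u - (v - mact M q' z').
      rewrite mactN; exact: subr_addr.
    exact: sgB.
  - by right; exists n, q, z; split=> //; rewrite addrAC; exact: sgB.
  right; have nn' := low_source qr q'r; subst n'.
  rewrite -(low_inj qr q'r) in hv; exists n, q, (z - z'); split=> //.
  have -> : u - v - mact M q (z - z') = (u - mact M q z) - (v - mact M q z').
    rewrite mactDr mactN; exact: subr_subr.
  exact: sgB.
move=> /(_ (SGroup mem0 memB)); apply=> j n q y; rewrite ltnS leq_eqVlt.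
case/orP => [/eqP -> qr|jr qj]; last by left; exact: dec_low qj.
by right; exists n, q, y; rewrite subrr; split=> //; exact: sg0.
Qed.

Lemma low_low_dec r i j n n' m (q1 : rhom (r := Q) n n') (q2 : rhom (r := Q) n' m)
    (y : M n) : (j < r)%N -> (j < i)%N -> (i < k)%N -> low j q1 -> low i q2 ->
  dec r m (mact M q2 (mact M q1 y)).
Proof.
move=> jr ji ik [b [b0 nb n'b q1b]] [a [a0 n'a ma q2a]].
pose good s := exists2 q : rhom (r := Q) n m, represents q s &
  forall y, dec r m (mact M q y).
have good0 : good 0.
  exists 0 => [|z]; first exact: represents0.
  by rewrite mact0l; exact: sg0.
have goodD s s' : good s -> good s' -> good (s + s').
  move=> [q qs qd] [q' qs' qd']; exists (q + q'); first exact: represents_add.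
  by move=> z; rewrite mactDl; apply: sgD.
suff [q qs qd] : good (Sq a * Sq b).
  rewrite -mactM (represents_inj (represents_comp q2a q1b) qs); exact: qd.
rewrite Sq_adem //; last by lia.
apply: (big_ind good) => // c _.
(* As a = 2b + j - i, a nonzero coefficient forces n - c < i < k, so that Sq^c on degree n belongs
   to Q_k. *)
case: (leqP (a - c.*2) (b - c - 1)) => h; last by rewrite bin_small // mulr0n.
have cS : (c <= a./2)%N by rewrite -ltnS.
elim: 'C(_, _) => [|l IH]; rewrite ?mulr0n // mulrS; apply: goodD => //.
have [||u uc] := represents_Sq_exists (n := n) (m := n + c%:Z) (i := c) => //.
  by lia.
have [||v vc] := represents_Sq_exists (n := n + c%:Z) (m := m) (i := (a + b - c)%N).
- by lia.
- by lia.
exists (rcomp v u); first exact: represents_comp.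
move=> z; rewrite mactM; case: (ltP (n + c%:Z) (a + b - c)%N%:Z) => vi.
  rewrite (represents_unstable vc _ vi); last by lia.
  by rewrite mact0l; exact: sg0.
(* The outer square is e_(j + 2c - a), whose index is at most j because c <= a/2; it is nonnegative
   by the case assumption. *)
apply: (@dec_low _ (j + c.*2 - a)); first by lia.
by exists (a + b - c)%N; split=> //; lia.
Qed.
End Decomposables.
End Qk.

(** * Injectivity of e_r modulo decomposables *)

Section Representable.
Variables (R : ringoid) (a : R).

Definition rep : lmodule R.
Proof.
refine (@LModule R (fun n => rhom a n) (fun n m f x => rcomp f x) _ _ _ _).
- by move=> n x; exact: rcomp1m.
- by move=> n m p g f x; rewrite rcompA.
- by move=> n m f g x; exact: rcompDl.
- by move=> n m f x y; exact: rcompDr.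
Defined.
End Representable.

Section Qk.
Variable k : nat.
Notation Q := (ringoidQk k).
Implicit Types (n m p : int).

Section Generation.
Variable M : lmodule Q.

(** It suffices to apply a generator e_l to some e_j y with j < r: for l < r the result is in D^r by
    definition, and for l >= r > j by the Adem relations. *)
Lemma dec_act r n m (q : rhom (r := Q) n m) (x : M n) :
  dec M r n x -> dec M r m (mact M q x).
Proof.
move: n m q x; apply: (hom_ind (P := fun n m q => forall x : M n,
  dec M r n x -> dec M r m (mact M q x))).
- by move=> n m x _; rewrite mact0l; exact: sg0.
- by move=> n m q q' hq hq' x dx; rewrite mactDl mactNl; apply: sgB; auto.
- by move=> n x; rewrite mact1.
- by move=> n m p q' q hq' hq x dx; rewrite mactM; auto.
move=> i n m q mn ni qi x.
have h0 : dec M r m (mact M q 0) by rewrite mact0; exact: sg0.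
have hB y z : dec M r m (mact M q y) -> dec M r m (mact M q z) ->
    dec M r m (mact M q (y - z)).
  by move=> hy hz; rewrite mactDr mactN; exact: sgB.
move=> /(_ (@SGroup (M n) (fun x => dec M r m (mact M q x)) h0 hB)); apply.
move=> j n' q1 y jr q1j; rewrite -[sg_mem _ _]/(dec M r m (mact M q (mact M q1 y))).
case: (posnP i) => [i0|i0].
  subst i; rewrite addr0 in mn; subst m.
  have -> : q = rid (r := Q) n.
    by apply: represents_inj qi _; rewrite Sq0; exact: represents_id.
  by rewrite mact1; exact: dec_low q1j.
case: (ltP n i%:Z) => hn.
  by rewrite (represents_unstable qi mn hn) mact0l; exact: sg0.
have [l nl] : exists l : nat, n = (i + l)%N%:Z.
  by exists `|n - i%:Z|%N; lia.
have ql : low l q by exists i.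
case: (ltnP l r) => lr; first exact: dec_low ql.
by apply: low_low_dec q1j ql => //; lia.
Qed.

(** The first generator that changes the degree lands in D^r, and D^r is a submodule. It is applied
    with r = k, with r = min(k, a), and with r >= a. *)
Lemma dec_gen r a n (q : rhom (r := Q) a n) (x : M a) :
  (forall j : nat, (j < k)%N -> j%:Z < a -> (j < r)%N) -> n <> a ->
  dec M r n (mact M q x).
Proof.
move=> ar; move: a n q x ar; apply: (hom_ind (P := fun a n q => forall x : M a,
  (forall j : nat, (j < k)%N -> j%:Z < a -> (j < r)%N) -> n <> a ->
  dec M r n (mact M q x))).
- by move=> n m x _ _; rewrite mact0l; exact: sg0.
- by move=> n m q q' hq hq' x ar nm; rewrite mactDl mactNl; apply: sgB; auto.
- by [].
- move=> n m p q' q hq' hq x nr np; rewrite mactM.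
  have [mn|mn] := pselect (m = n); first by subst m; exact: hq'.
  by apply: dec_act; exact: hq.
move=> i n m q mn ni qi x nr nm.
case: (ltP n i%:Z) => hn.
  by rewrite (represents_unstable qi mn hn) mact0l; exact: sg0.
have i0 : (0 < i)%N by case: (i) mn nm => // ->; rewrite addr0.
have [l nl] : exists l : nat, n = (i + l)%N%:Z.
  by exists `|n - i%:Z|%N; lia.
apply: (@dec_low _ _ _ l); last by exists i.
by apply: nr; lia.
Qed.
End Generation.

Lemma hom_source_neg b n (q : rhom (r := Q) b n) : b < 0 -> q = 0.
Proof.
move=> b0; rewrite -[q]rcompm1 (rid_neg _ b0).
exact: (mact0 (rep (R := Q) b)).
Qed.

Lemma hom_target_neg b n (q : rhom (r := Q) b n) : n < 0 -> q = 0.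
Proof.
move=> n0; rewrite -[q]rcomp1m (rid_neg _ n0).
exact: (mact0l (M := rep (R := Q) b)).
Qed.

Section ModelEvaluation.
Variable a : nat.
Implicit Types (c : expo a) (y : expo a -> 'F_2).

(** By instability of the polynomial model, evaluation on families of degree n factors through Q. *)
Lemma steenrod_act_ideal n m (f : rhom (r := ringoidA) n m) y c :
  oigen unstable_rel n m f -> supported n y -> steenrod_act (ssval f) y c = 0.
Proof.
pose mem n m (f : rhom (r := ringoidA) n m) :=
  forall y c, supported n y -> steenrod_act (ssval f) y c = 0.
have m0 n' m' : mem n' m' 0.
  by move=> z d _; have := steenrod_actB 0 0 z d; rewrite !subrr.
have mB n' m' g g' : mem n' m' g -> mem n' m' g' -> mem n' m' (g - g').
  move=> hg hg' z d zn; rewrite -[ssval _]/(ssval g - ssval g' : steenrod).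
  by rewrite steenrod_actB hg // hg' // subrr.
have ml n' m' p' (g : rhom (r := ringoidA) m' p') (h : rhom (r := ringoidA) n' m') :
    mem n' m' h -> mem n' p' (rcomp g h).
  by move=> hh z d zn; rewrite /= steenrod_actM steenrod_act_eq0 // => e; exact: hh.
have mr n' m' p' (g : rhom (r := ringoidA) m' p') (h : rhom (r := ringoidA) n' m') :
    mem m' p' g -> mem n' p' (rcomp g h).
  move=> hg z d zn; rewrite /= steenrod_actM hg //.
  by apply: steenrod_act_supported zn; exact: ssubP h.
pose I := @OIdeal ringoidA (fun n m => SGroup (m0 n m) (mB n m)) ml mr.
move=> /(_ I); apply=> n' m' g [i ni [mn gi]] z d zn.
by rewrite gi steenrod_act_Sq (sqop_unstable _ zn).
Qed.

Lemma steenrod_act_represents n m (q : rhom (r := Q) n m) s s' y c :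
  represents q s -> represents q s' -> supported n y ->
  steenrod_act s y c = steenrod_act s' y c.
Proof.
move=> [f [<- qf]] [f' [<- qf']] yn; apply/eqP; rewrite -subr_eq0 -steenrod_actB.
apply/eqP; apply: (@steenrod_act_ideal _ _ (f - f')) => //.
by apply/qproj_eq; rewrite -qf.
Qed.

(* The monomial x_1 ... x_a. *)
Definition iota_class c : 'F_2 := (c == [ffun=> 0%N])%:R.

Lemma iota_supported : supported a iota_class.
Proof.
move=> c; rewrite /iota_class; case: (c =P _) => [-> _|_]; last by rewrite eqxx.
by rewrite /mdegree; under eq_bigr do rewrite ffunE; rewrite sum1_card card_ord.
Qed.

Definition ev n (q : rep (R := Q) a n) : expo a -> 'F_2 :=
  steenrod_act (projT1 (cid (represents_exists q))) iota_class.

Lemma evE n (q : rep (R := Q) a n) s c :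
  represents q s -> ev q c = steenrod_act s iota_class c.
Proof.
rewrite /ev; case: cid => s' /= qs' qs.
exact: steenrod_act_represents qs' qs iota_supported.
Qed.

Lemma evB n (q q' : rep (R := Q) a n) c : ev (q - q') c = ev q c - ev q' c.
Proof.
have [s qs] := represents_exists q; have [s' qs'] := represents_exists q'.
by rewrite (evE _ qs) (evE _ qs') -steenrod_actB; apply: evE; exact: represents_sub.
Qed.

Lemma ev0 n c : ev (0 : rep (R := Q) a n) c = 0.
Proof. by rewrite -(subrr 0) evB subrr. Qed.

Lemma ev_supported n (q : rep (R := Q) a n) : supported n (ev q).
Proof.
have [s qs] := represents_exists q => c; rewrite (evE _ qs).
by apply: steenrod_act_supported iota_supported c; exact: represents_homog qs.
Qed.

Lemma ev_act (i : nat) n m (q : rhom (r := Q) n m) (x : rep (R := Q) a n) c :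
  represents q (Sq i) -> ev (mact (rep (R := Q) a) q x) c = sqop i (ev x) c.
Proof.
move=> qi; have [s xs] := represents_exists x.
rewrite (evE _ (represents_comp qi xs)) steenrod_actM steenrod_act_Sq.
by apply: sqop_ext => d; rewrite (evE _ xs).
Qed.

Lemma ev_dec r n (x : rep (R := Q) a n) c :
  dec (rep (R := Q) a) r n x -> (r <= zeros c)%N -> ev x c = 0.
Proof.
move=> dx; move: c.
pose mem (x : rep (R := Q) a n) := forall c, (r <= zeros c)%N -> ev x c = 0.
have m0 : mem 0 by move=> c _; exact: ev0.
have mB u v : mem u -> mem v -> mem (u - v).
  by move=> hu hv c rc; rewrite evB hu // hv // subrr.
apply: (dx (SGroup m0 mB)) => j n' q y jr [i [_ nij _ qi]] c rc.
rewrite (ev_act _ _ qi); apply: sqop_zeros (@ev_supported _ y) nij _.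
exact: leq_trans jr rc.
Qed.

Lemma ev_low_eq0 r n m (q : rhom (r := Q) n m) (x : rep (R := Q) a n) :
  low r q -> (forall c, zeros c = r -> ev (mact (rep (R := Q) a) q x) c = 0) ->
  forall c, (r <= zeros c)%N -> ev x c = 0.
Proof.
move=> [i [_ nij _ qi]] H; apply: (sqop_zeros_inj (@ev_supported _ x) nij) => c cr.
by rewrite -(ev_act _ _ qi) H.
Qed.

(** Converse of [ev_dec], by induction on the degree n. In degree a the identity is excluded because
    x_1 ... x_a has a >= r exponents 1. In other degrees x lies in D^min(k, a), and one descends
    from D^(K+1) to D^K until r is reached. *)
Lemma ev_zeros_dec r n (x : rep (R := Q) a n) : (r <= a)%N ->
  (forall c, (r <= zeros c)%N -> ev x c = 0) -> dec (rep (R := Q) a) r n x.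
Proof.
have [N] : exists N : nat, n < N%:Z by exists `|n|.+1; lia.
elim: N r n x => [|N IH] r n x nN ra xr.
  by rewrite (hom_target_neg x nN); exact: sg0.
have [na|na] := pselect (n = a%:Z).
  subst n; case: (hom_id x) => [->|xid]; first exact: sg0.
  have := xr [ffun=> 0%N]; rewrite xid (evE _ (represents_id _ _)) steenrod_act1.
  rewrite /iota_class eqxx => e; have := e _; rewrite /zeros.
  suff -> : #|[pred l | ([ffun=> 0%N] : expo a) l == 0%N]| = a.
    by move=> /(_ ra)/eqP; rewrite oner_eq0.
  by rewrite -[RHS]card_ord; apply: eq_card => l; rewrite !inE ffunE.
have xK : dec (rep (R := Q) a) (minn k a) n x.
  have -> : x = mact (rep (R := Q) a) x (rid (r := Q) a) by symmetry; exact: rcompm1.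
  by apply: dec_gen na => j jk; lia.
case: (leqP (minn k a) r) => [Kr|rK]; first exact: dec_le Kr xK.
have: (r <= minn k a)%N by exact: ltnW.
have: (minn k a <= a)%N by exact: geq_minr.
elim: (minn k a) xK => [|K IHK] xK Ka; first by rewrite leqn0 => /eqP ->.
rewrite leq_eqVlt => /orP[/eqP -> //|]; rewrite ltnS => rK'.
apply: (IHK _ _ rK'); last exact: ltnW.
(* Modulo D^K, x is e_K z with z of lower degree. Neither x nor the difference has monomials with
   exactly K exponents 1, so e_K z has none, and z lies in D^K by induction. *)
case: (decS xK) => // -[n' [q [z [qK dz]]]].
rewrite -[x](subrK (mact (rep (R := Q) a) q z)); apply: sgD => //.
apply: dec_act; apply: IH; [|exact: ltnW|].
  by case: qK => i [i0 ni mi _]; lia.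
apply: (ev_low_eq0 qK) => c cK.
have := evB x (mact (rep (R := Q) a) q z) c.
have -> := ev_dec dz (eq_leq (esym cK)).
have -> : ev x c = 0 by apply: xr; rewrite cK.
rewrite sub0r => /esym/eqP.
by rewrite oppr_eq0 => /eqP.
Qed.
End ModelEvaluation.

Definition low_injective (M : lmodule Q) :=
  forall r n m (q : rhom (r := Q) n m) (x : M n),
  (r < k)%N -> low r q -> dec M r m (mact M q x) -> dec M r n x.

Lemma rep_low_injective (a : Q) : low_injective (rep a).
Proof.
move=> r n m q x rk qr dqx; case: (ltP (a : int) 0) => [a0|].
  by rewrite (hom_source_neg x a0); exact: sg0.
case: a x dqx => // a x dqx _.
(* If a <= r, the degree n = i + r of x exceeds a, and everything outside degree a lies in D^r; the
   model serves the case r < a. *)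
case: (leqP a r) => ar.
  have -> : x = mact (rep (R := Q) a) x (rid (r := Q) a) by symmetry; exact: rcompm1.
  apply: dec_gen => [j jk|na]; first by lia.
  by case: qr => i [i0 ni _ _]; lia.
apply: ev_zeros_dec (ltnW ar) _; apply: ev_low_eq0 qr _ => c cr.
by apply: ev_dec dqx _; rewrite cr.
Qed.
End Qk.

(** * Coordinates on free modules *)

Section FreeComponents.
Variables (R : ringoid) (M : lmodule R).
Notation F := (free_module M).
Notation gen := {a : R & M a}.

Definition yoneda (N : lmodule R) (a : R) (x : N a) : lmap (rep a) N.
Proof.
exists (fun n (q : rep a n) => mact N q x) => [n p q|n m f q].
  exact: mactDl.
exact: mactM.
Defined.

(** The dual basis vector of [g]. The identity has to be transported, since the degrees agree only
    through the equality [e] of generators. *)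
Definition dual_assignment (g : gen) : assignment M (rep (projT1 g)) :=
  fun a x => match pselect (existT _ a x = g) with
    | left e => eq_rect_r (fun h : gen => rhom (projT1 g) (projT1 h)) (rid (projT1 g)) e
    | right _ => 0
    end.

Definition coordinate (g : gen) : lmap F (rep (projT1 g)) :=
  free_ext (dual_assignment g).

Definition component (g : gen) : lmap F F :=
  lmap_comp (yoneda (fgen (projT2 g))) (coordinate g).

Lemma component_gen (g : gen) :
  component g (projT1 g) (fgen (projT2 g)) = fgen (projT2 g).
Proof.
rewrite /component /= -[qeval _ _]/(coordinate g _ _) /coordinate free_ext_gen.
rewrite /dual_assignment; case: g => a x /=; case: pselect => // e.
by rewrite (Prop_irrelevance e erefl) /eq_rect_r; exact: (mact1 (l := F)).
Qed.

Lemma component_gen0 (g : gen) a (x : M a) : existT _ a x <> g ->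
  component g a (fgen x) = 0.
Proof.
move=> xg; rewrite /component /= -[qeval _ _]/(coordinate g _ _) /coordinate free_ext_gen.
by rewrite /dual_assignment; case: pselect => // _; exact: (mact0l (M := F)).
Qed.

(* For distinct g the [component g] are orthogonal idempotents; the remainder is
   the product of the complementary ones over l, and vanishes on the submodule
   generated by l. *)
Fixpoint remainder (l : seq gen) n (z : F n) : F n :=
  if l is g :: l' then remainder l' (z - component g n z) else z.

Lemma remainder_cons g l n (z : F n) :
  remainder (g :: l) z = remainder l (z - component g n z).
Proof. by []. Qed.

Lemma remainderB l n (z z' : F n) : remainder l (z - z') = remainder l z - remainder l z'.
Proof.
elim: l z z' => // g l IH z z'.
by rewrite !remainder_cons -IH mappD mappN subr_subr.
Qed.

Lemma remainder0 l n : remainder l (0 : F n) = 0.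
Proof. by rewrite -[0 in LHS](subrr 0) remainderB subrr. Qed.

Lemma remainder_act l n m (f : rhom n m) (z : F n) :
  remainder l (mact F f z) = mact F f (remainder l z).
Proof.
elim: l z => // g l IH z.
by rewrite !remainder_cons -IH mactDr mactN mapp_nat.
Qed.

Lemma remainder_gen l (g : gen) : List.In g l -> remainder l (fgen (projT2 g)) = 0.
Proof.
elim: l => // g' l IH gl; rewrite remainder_cons.
have [<-|gg'] := pselect (g = g'); first by rewrite component_gen subrr remainder0.
rewrite component_gen0; last by case: (g) gg'.
by rewrite subr0; apply: IH; case: gl => // /esym.
Qed.

Fixpoint generators n (t : fterm M n) : seq gen :=
  match t with
  | FGen a x f => [:: existT _ a x]
  | FZero => [::]
  | FOpp s => generators s
  | FAdd s t => generators s ++ generators t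
  end.

Lemma remainder_generators l n (t : fterm M n) :
  (forall g, List.In g (generators t) -> List.In g l) ->
  remainder l (feval (@fgen R M) t) = 0.
Proof.
elim: t => [a x f||s IHs|s IHs t IHt] /= tl.
- by rewrite remainder_act (remainder_gen (tl _ (or_introl erefl))) mact0.
- exact: remainder0.
- by rewrite -[- _]sub0r remainderB remainder0 IHs // subrr.
have hs : remainder l (feval (@fgen R M) s) = 0.
  by apply: IHs => g gs; apply: tl; apply: List.in_or_app; left.
have ht : remainder l (feval (@fgen R M) t) = 0.
  by apply: IHt => g gt; apply: tl; apply: List.in_or_app; right.
rewrite -[feval (@fgen R M) t]opprK remainderB hs -[- feval (@fgen R M) t]sub0r.
by rewrite remainderB remainder0 ht !subrr.
Qed.
End FreeComponents.

(** * Injectivity of e_r, from representable to projective modules *)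

Section Qk.
Variable k : nat.
Notation Q := (ringoidQk k).

Lemma dec_map (M N : lmodule Q) (u : lmap M N) (r : nat) (n : int) (x : M n) :
  dec M r n x -> dec N r n (u n x).
Proof.
have m0 : dec N r n (u n 0) by rewrite mapp0; exact: sg0.
have mB y z : dec N r n (u n y) -> dec N r n (u n z) -> dec N r n (u n (y - z)).
  by move=> hy hz; rewrite mappD mappN; exact: sgB.
move=> /(_ (@SGroup (M n) (fun x => dec N r n (u n x)) m0 mB)); apply.
move=> j n' q y jr qj; rewrite -[sg_mem _ _]/(dec N r n (u n (mact M q y))) mapp_nat.
exact: dec_low qj.
Qed.

(** The coordinates of x are in D^r by the representable case, and x is recovered from the finitely
    many components at the generators of a term for it. *)
Lemma free_low_injective (M : lmodule Q) : low_injective (free_module M).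
Proof.
move=> r n m q x rk qr dqx.
have xZ g : dec (rep (projT1 g)) r n (coordinate g n x).
  apply: rep_low_injective rk qr _; rewrite -mapp_nat; exact: dec_map.
have dR l z : (forall g, dec (rep (projT1 g)) r n (coordinate g n z)) ->
    dec (free_module M) r n (remainder l z) -> dec (free_module M) r n z.
  elim: l z => // g l IH z zZ; rewrite remainder_cons => /IH dz.
  have dg : dec (free_module M) r n (component g n z).
    exact: (dec_map (yoneda (fgen (projT2 g))) (zZ g)).
  rewrite -[z](subrK (component g n z)); apply: sgD => //; apply: dz => g'.
  rewrite mappD mappN; apply: sgB => //; exact: dec_map.
have xR : remainder (generators (repr x)) x = 0.
  by rewrite -{2}[x]fpi_repr -feval_fgen; exact: remainder_generators.
by apply: (dR (generators (repr x))) => //; rewrite xR; exact: sg0.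
Qed.

Lemma projective_low_injective (P : lmodule Q) : projective P -> low_injective P.
Proof.
move=> Pproj r n m q x rk qr dqx.
have idD n' (y z : P n') : y + z = y + z by [].
have idN n' m' (f : rhom n' m') (y : P n') : mact P f y = mact P f y by [].
(* The identity of P lifts through its free cover, so P is a retract of a free module. *)
have [h /(congr1 (fun u : lmap P P => u n x)) /= <-] :=
  Pproj _ _ (free_cover P) (MMap idD idN) (@free_cover_surj _ P).
apply: (@dec_map _ _ (free_cover P)); apply: free_low_injective rk qr _.
by rewrite -mapp_nat; exact: dec_map.
Qed.
End Qk.

(** * Resolutions and extension of cocycles *)

Section Resolution.
Variables (k : nat) (M : lmodule (ringoidQk k)) (P : proj_resolution M).

Lemma res_dd s (n : int) (x : P s.+2 n) : res_d P s n (res_d P s.+1 n x) = 0.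
Proof. by apply/res_exactS; exists x. Qed.

Lemma resolution_mod_dec r s (m : int) (x : P s.+1 m) : (r <= k)%N -> (r <= s)%N ->
  dec (P s) r m (res_d P s m x) ->
  exists y : P s.+2 m, dec (P s.+1) r m (x - res_d P s.+1 m y).
Proof.
elim: r s m x => [|r IH] s m x rk rs dx.
  have /res_exactS[y yx] := dec0 dx.
  by exists y; rewrite yx subrr; exact: sg0.
case: s x rs dx => // s x rs /decS[dx|[n [q [z [qr dx]]]]].
  have [y dy] := IH _ _ _ (ltnW rk) (ltnW rs) dx.
  by exists y; exact: dec_le dy.
(* Applying the differential to d x - e_r z shows that e_r (d z) lies in D^r, and e_r is injective
   modulo D^r. *)
have dz : dec (P s) r n (res_d P s n z).
  apply: (projective_low_injective (@res_proj _ _ P s)) rk qr _.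
  have := dec_map (res_d P s) dx; rewrite mappD mappN res_dd sub0r mapp_nat.
  by move=> /sgN; rewrite opprK.
have [w dw] := IH _ _ _ (ltnW rk) rs dz.
(* Correcting x by e_r w, an element of D^(r+1), brings its differential into D^r. *)
have [|y dy] := IH s.+1 m (x - mact (P s.+2) q w) (ltnW rk) (ltnW rs).
  rewrite mappD mappN mapp_nat.
  have -> : res_d P s.+1 m x - mact (P s.+1) q (res_d P s.+1 n w) =
      (res_d P s.+1 m x - mact (P s.+1) q z) + mact (P s.+1) q (z - res_d P s.+1 n w).
    by rewrite mactDr mactN addrA subrK.
  by apply: sgD => //; exact: dec_act.
exists y; have -> : x - res_d P s.+2 m y =
    (x - mact (P s.+2) q w - res_d P s.+2 m y) + mact (P s.+2) q w.
  by rewrite addrAC subrK.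
by apply: sgD; [exact: dec_le dy|exact: dec_low qr].
Qed.
End Resolution.

(** * Extension of additive maps on groups of exponent 2 *)

Section LinearExtension.
Local Open Scope classical_set_scope.
Local Open Scope ring_scope.
Variables (X V W : zmodType) (f : X -> V) (h : X -> W) (D : sgroup V).
Hypothesis (V2 : forall v : V, v + v = 0).
Hypothesis (fB : {morph f : x y / x - y}) (hB : {morph h : x y / x - y}).
Hypothesis (fD : forall x, D (f x) -> h x = 0).

(** The graph of the map prescribed on f(X) + D. *)
Definition graph0 (p : V * W) : Prop := exists x, D (p.1 - f x) /\ p.2 = h x.

Definition partial_map (A : set (V * W)) : Prop :=
  [/\ forall p, graph0 p -> A p, forall p q, A p -> A q -> A (p - q)
    & forall w, A (0, w) -> w = 0].

Lemma partial_map_graph0 : partial_map graph0.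
Proof.
split=> // [p q [x [px p2]] [y [qy q2]]|w [x /= [dx ->]]].
  exists (x - y); rewrite /= p2 q2 hB; split=> //.
  by rewrite fB subr_subr; exact: sgB.
by apply: fD; have /sgN := dx; rewrite sub0r opprK.
Qed.

Lemma partial_map_0 A : partial_map A -> A (0, 0).
Proof.
move=> [A0 AB _]; have p0 : A (f 0, h 0).
  by apply: A0; exists 0; rewrite /= subrr; split=> //; exact: sg0.
by have := AB _ _ p0 p0; rewrite subrr.
Qed.

(** The new vector gets the value 0. Since 2 v0 = 0, the enlarged domain is the union of just two
    cosets of the old one. *)
Lemma partial_map_adjoin A v0 : partial_map A -> (forall w, ~ A (v0, w)) ->
  partial_map (fun p => A p \/ A (p.1 - v0, p.2)).
Proof.
move=> PA v0A; have A00 := partial_map_0 PA; case: PA => [A0 AB A1].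
have AB' v w v' w' : A (v, w) -> A (v', w') -> A (v - v', w - w') by exact: AB.
have v0N u : u + v0 = u - v0.
  by congr (u + _); apply/eqP; rewrite -addr_eq0 V2.
split=> [p /A0|[v w] [v' w']|w]; first by left.
- case=> /= Av [] /= Av'; have := AB' _ _ _ _ Av Av'.
  + by left.
  + have -> : v - (v' - v0) = v - v' - v0 by rewrite -[RHS]v0N opprB addrA addrAC.
    by right.
  + by rewrite addrAC; right.
  + by rewrite subr_subr subrr subr0; left.
case=> [/A1 //|]; rewrite /= sub0r => Av; case: (v0A (- w)).
by have := AB' _ _ _ _ A00 Av; rewrite !sub0r opprK.
Qed.

Lemma linear_extension : exists phi : V -> W,
  [/\ {morph phi : u v / u - v}, forall x, phi (f x) = h x
    & forall v, D v -> phi v = 0].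
Proof.
have [F Fp Ftot|A [PA Amax]] :=
    @Zorn_bigcup (V * W) (fun A => A = set0 \/ partial_map A).
  have [[A FA A0]|Fe] := pselect (exists2 A, F A & A !=set0); last first.
    left; rewrite -subset0 => p [A FA Ap]; apply: Fe; exists A => //.
    by exists p.
  have Fpart B : F B -> B !=set0 -> partial_map B.
    by move=> /Fp[->|//] [].
  right; split.
  - by move=> p gp; exists A => //; case: (Fpart A FA A0) => + _ _; apply.
  - move=> p q [B FB Bp] [C FC Cq].
    have [BC|CB] := Ftot _ _ FB FC.
      exists C => //; have [|_ + _] := Fpart _ FC; first by exists q.
      by apply => //; exact: BC.
    exists B => //; have [|_ + _] := Fpart _ FB; first by exists p.
    by apply => //; exact: CB.
  - move=> w [B FB Bw]; have [|_ _] := Fpart _ FB; first by exists (0, w).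
    exact.
have {}PA : partial_map A.
  case: PA => // A0; exfalso; apply: (Amax graph0); last first.
    by right; exact: partial_map_graph0.
  rewrite A0; split=> [p []|/(_ (f 0, h 0))]; apply.
  by exists 0; rewrite /= subrr; split=> //; exact: sg0.
have Atot v : exists w, A (v, w).
  apply: contrapT => /forallNP v0A.
  apply: (Amax (fun p => A p \/ A (p.1 - v, p.2))); last first.
    by right; exact: partial_map_adjoin.
  split=> [p Ap|/(_ (v, 0)) AS]; first by left.
  apply: (v0A 0); apply: AS; right; rewrite /= subrr; exact: partial_map_0.
have A00 := partial_map_0 PA; have [A0 AB A1] := PA.
have Ainj v w w' : A (v, w) -> A (v, w') -> w = w'.
  move=> Aw Aw'; apply/eqP; rewrite -subr_eq0; apply/eqP; apply: A1.
  by have := AB _ _ Aw Aw'; rewrite -[_ - _]/(v - v, w - w') subrr.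
exists (fun v => projT1 (cid (Atot v))); split.
- move=> u v; do 3!case: cid => ? /=; move=> Av Au Auv.
  by apply: Ainj Auv _; exact: AB Au Av.
- move=> x; case: cid => w /= Aw; apply: Ainj Aw _; apply: A0; exists x.
  by rewrite /= subrr; split=> //; exact: sg0.
- move=> v Dv; case: cid => w /= Aw; apply: Ainj Aw _; apply: A0; exists 0.
  have f0 : f 0 = 0 by have := fB 0 0; rewrite !subrr.
  have h0 : h 0 = 0 by have := hB 0 0; rewrite !subrr.
  by rewrite /= f0 subr0 h0.
Qed.
End LinearExtension.

(** * Truncations and modules concentrated in one degree *)

Section Concentrated.
Variables (k : nat) (N : lmodule (ringoidQk k)) (d : int).
Notation Q := (ringoidQk k).
Implicit Types (a b : int).

Definition truncation_sg b : sgroup (N b).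
Proof.
exists (fun x => b < d -> x = 0) => // x y hx hy bd.
by rewrite hx // hy // subrr.
Defined.

Lemma truncation_act a b (f : rhom (r := Q) a b) (x : ssub (truncation_sg a)) :
  truncation_sg b (mact N f (ssval x)).
Proof.
move=> bd; case: (ltP a d) => ad; first by rewrite (ssubP x ad) mact0.
by rewrite (hom_neg f (lt_le_trans bd ad)) mact0l.
Qed.

Definition truncation : lmodule Q.
Proof.
refine (@LModule Q (fun b => ssub (truncation_sg b))
  (fun a b f x => mkssub (truncation_act f x)) _ _ _ _).
- by move=> a x; apply: val_inj; rewrite /= mact1.
- by move=> a b c g f x; apply: val_inj; rewrite /= mactM.
- by move=> a b f g x; apply: val_inj; rewrite /= mactDl.
- by move=> a b f x y; apply: val_inj; rewrite /= mactDr.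
Defined.

Definition truncation_incl : lmap truncation N.
Proof. by exists (fun a (x : ssub (truncation_sg a)) => ssval x). Defined.

Definition slice_sg b : sgroup (N b).
Proof.
exists (fun x => b != d -> x = 0) => // x y hx hy bd.
by rewrite hx // hy // subrr.
Defined.

Definition slice_act a b (f : rhom (r := Q) a b) (x : N a) : N b :=
  if (a == d) && (b == d) then mact N f x else 0.

Lemma slice_actP a b (f : rhom (r := Q) a b) (x : N a) : slice_sg b (slice_act f x).
Proof. by rewrite /slice_act => /= /negbTE ->; rewrite andbF. Qed.

Lemma slice_actM a b c (g : rhom (r := Q) b c) (f : rhom (r := Q) a b) (x : N a) :
  slice_act (rcomp g f) x = slice_act g (slice_act f x).
Proof.
rewrite /slice_act mactM; case: (eqVneq b d) => [bd|bd] /=.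
  by rewrite andbT; case: (a == d); case: (c == d); rewrite //= mact0.
case: ifP => // /andP[/eqP ad /eqP cd].
case: (ltgtP b d) bd => // bd _.
  have bda : b < a by rewrite ad.
  by rewrite (hom_neg f bda) mact0l mact0.
have cdb : c < b by rewrite cd.
by rewrite (hom_neg g cdb) mact0l.
Qed.

Definition slice : lmodule Q.
Proof.
refine (@LModule Q (fun b => ssub (slice_sg b))
  (fun a b f x => mkssub (slice_actP f (ssval x))) _ _ _ _).
- move=> a x; apply: val_inj; rewrite /= /slice_act andbb mact1.
  by case: ifPn => // /(ssubP x).
- by move=> a b c g f x; apply: val_inj; rewrite /= slice_actM.
- move=> a b f g x; apply: val_inj; rewrite /= /slice_act mactDl.
  by case: ifP; rewrite ?addr0.
- move=> a b f x y; apply: val_inj; rewrite /= /slice_act mactDr.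
  by case: ifP; rewrite ?addr0.
Defined.

Lemma slice_projP b (x : N b) : slice_sg b (if b == d then x else 0).
Proof. by move=> /= /negbTE ->. Qed.

Definition slice_proj : lmap truncation slice.
Proof.
exists (fun b (x : ssub (truncation_sg b)) => mkssub (slice_projP (ssval x))).
  by move=> a x y; apply: val_inj => /=; case: ifP; rewrite ?addr0.
move=> a b f x; apply: val_inj; rewrite /= /slice_act.
case: (eqVneq b d) => [bd|bd]; last by rewrite andbF.
rewrite andbT; case: (ltgtP a d) => // ad.
  by rewrite (ssubP x ad) mact0.
have ba : b < a by rewrite bd.
by rewrite (hom_neg f ba) mact0l.
Defined.

Lemma slice_proj_surj : msurj slice_proj.
Proof.
move=> b y; have yP : truncation_sg b (ssval y).
  by move=> bd; apply: (ssubP y); rewrite lt_eqF.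
exists (mkssub yP); apply: val_inj => /=.
by case: ifPn => // /(ssubP y).
Qed.

(** In degree d everything coming from lower degrees lies in D^k, so [psi] is a module map to the
    slice. It lifts to the truncation by projectivity, hence the vanishing below d. *)
Lemma projective_slice_lift (P : lmodule Q) (psi : forall b, P b -> N b) :
  projective P ->
  (forall b x y, psi b (x + y) = psi b x + psi b y) ->
  (forall b x, b != d -> psi b x = 0) ->
  (forall b (x : P b), dec P k b x -> psi b x = 0) ->
  exists g : lmap P N, (forall x, g d x = psi d x) /\
    forall b (x : P b), b < d -> g b x = 0.
Proof.
move=> Pproj psiD psi0 psid.
have psi_slice b (x : P b) : slice_sg b (psi b x) by exact: psi0.
pose u b (x : P b) : slice b := mkssub (psi_slice b x).
have uD b x y : u b (x + y) = u b x + u b y by apply: val_inj; rewrite /= psiD.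
have uN a b (f : rhom (r := Q) a b) (x : P a) :
    u b (mact P f x) = mact slice f (u a x).
  apply: val_inj; rewrite /= /slice_act.
  have [bd|bd] := eqVneq b d; last by rewrite andbF psi0.
  rewrite andbT; case: (eqVneq a d) => [ad|ad].
    have ab : a = b by rewrite ad bd.
    clear bd ad; subst b; case: (hom_id f) => ->; last by rewrite !mact1.
    rewrite !mact0l; apply: psid; exact: sg0.
  apply: psid; apply: dec_gen => [j //|ba].
  by rewrite -ba bd eqxx in ad.
have [h hE] := Pproj _ _ slice_proj (@MMap Q P slice u uD uN) slice_proj_surj.
exists (lmap_comp truncation_incl h); split=> [x|b x bd].
  have := congr1 (fun v : lmap P slice => ssval (v d x)) hE.
  by rewrite /= eqxx.
exact: (ssubP (h b x)).
Qed.
End Concentrated.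

(** * Extension of cocycles, degree by degree *)

Section Vanishing.
Variables (k : nat) (M N : lmodule (ringoidQk k)) (P : proj_resolution M).
Notation Q := (ringoidQk k).

Lemma module_char2 (X : lmodule Q) (n : Q) (x : X n) : x + x = 0.
Proof.
have e : rid (r := Q) n + rid (r := Q) n = 0.
  apply: represents_inj (represents_add (represents_id _ _) (represents_id _ _)) _.
  by rewrite steenrod_char2; exact: represents0.
by rewrite -[x]mact1 -mactDl e mact0l.
Qed.

Lemma module_neg (X : lmodule Q) (n : Q) (x : X n) : (n : int) < 0 -> x = 0.
Proof. by move=> n0; rewrite -[x]mact1 (rid_neg _ n0) mact0l. Qed.

Variable (t : nat) (f : lmap (P t.+1) N).
Hypothesis (kt : (k <= t)%N) (fZ : lmap_comp f (res_d P t.+1) = 0).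

Definition extends_below (d : int) (G : lmap (P t) N) :=
  forall b (x : P t.+1 b), (b : int) < d -> G b (res_d P t b x) = f b x.

(* The error vanishes below d, hence on the decomposables of degree d, and thus
   only the resolution modulo decomposables matters. *)
Lemma extend_step (d : int) (G : lmap (P t) N) : extends_below d G ->
  exists2 G' : lmap (P t) N, extends_below (d + 1) G' &
    forall b (x : P t b), (b : int) < d -> G' b x = G b x.
Proof.
move=> Gd.
pose h b (x : P t.+1 b) := f b x - G b (res_d P t b x).
have hB b x y : h b (x - y) = h b x - h b y.
  by rewrite /h !mappD !mappN subr_subr.
have hD b x y : h b (x + y) = h b x + h b y.
  by rewrite /h !mappD opprD addrACA.
have hN a b (q : rhom (r := Q) a b) x : h b (mact _ q x) = mact N q (h a x).
  by rewrite /h !mapp_nat mactDr mactN.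
have hd b x : h b (res_d P t.+1 b x) = 0.
  rewrite /h; have /= -> := congr1 (fun u : lmap (P t.+2) N => u b x) fZ.
  by rewrite res_dd mapp0 subr0.
have hdec x : dec (P t.+1) k d x -> h d x = 0.
  have h0 : h d 0 = 0 by have := hB d 0 0; rewrite !subrr.
  have hS u v : h d u = 0 -> h d v = 0 -> h d (u - v) = 0.
    by move=> hu hv; rewrite hB hu hv subrr.
  move=> /(_ (@SGroup (P t.+1 d) (fun x => h d x = 0) h0 hS)); apply.
  move=> j n q y jk [i [i0 ni di _]]; rewrite /= hN.
  have nd : n < d by rewrite di ltrDl.
  by rewrite /h Gd // subrr mact0.
have [phi [phiB phif phid]] : exists phi : P t d -> N d,
    [/\ {morph phi : u v / u - v}, forall x, phi (res_d P t d x) = h d x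
      & forall v, dec (P t) k d v -> phi v = 0].
  apply: linear_extension => [v|x y||x dx].
  - exact: module_char2.
  - by rewrite mappD mappN.
  - exact: hB.
  (* If d x is decomposable, x is a boundary plus a decomposable, and the error [h] vanishes on
     both. *)
  have [y dy] := resolution_mod_dec (leqnn k) kt dx.
  by rewrite -[x](subrK (res_d P t.+1 d y)) hD (hdec _ dy) hd addr0.
(* Extending [phi] by 0 to all degrees is done through existence and choice, to avoid transport
   along b = d. *)
have psi_ex b : exists psi : P t b -> N b,
    [/\ {morph psi : u v / u + v}, b != d -> psi = fun=> 0,
        b = d -> forall x, psi (res_d P t b x) = h b x
      & forall v, dec (P t) k b v -> psi v = 0].
  have [bd|bd] := eqVneq b d; last first.
    by exists (fun=> 0); split=> // [u v|bd']; [rewrite addr0|rewrite bd' eqxx in bd].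
  subst b; exists phi; split=> // u v.
  have phi0 : phi 0 = 0 by apply: phid; exact: sg0.
  have phiN w : phi (- w) = - phi w by rewrite -[- w]sub0r phiB phi0 sub0r.
  by rewrite -{1}[v]opprK phiB phiN opprK.
pose psi b := projT1 (cid (psi_ex b)).
have [g [gd gb]] : exists g : lmap (P t) N, (forall x, g d x = psi d x) /\
    forall b (x : P t b), b < d -> g b x = 0.
  apply: projective_slice_lift (@res_proj _ _ P t) _ _ _ => b x.
  - by move=> y; rewrite /psi; case: cid => ? [].
  - by rewrite /psi; case: cid => ? /= [_ + _ _] bd => ->.
  - by rewrite /psi; case: cid => ? /= [_ _ _]; apply.
exists (G + g) => [b x|b x bd]; last by rewrite -[RHS]addr0 -(gb b x bd).
rewrite -[(G + g) b _]/(G b _ + g b (res_d P t b x)) ltzD1 le_eqVlt.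
case/orP => [/eqP bd|bd]; last by rewrite gb // addr0 Gd.
subst b; rewrite gd /psi; case: cid => ? /= [_ _ -> // _].
by rewrite /h addrC subrK.
Qed.

(** The construction starts at degree 0, below which all modules vanish; the successive maps
    stabilize in each degree, and g is their limit. *)
Lemma cocycle_extends : exists g : lmap (P t) N, lmap_comp g (res_d P t) = f.
Proof.
(* The hypothesis is placed under the existential so that choice gives a total function to
   iterate. *)
have step (d : nat) (G : lmap (P t) N) : exists G' : lmap (P t) N,
    extends_below d%:Z G -> extends_below d.+1%:Z G' /\
      forall b (x : P t b), (b : int) < d%:Z -> G' b x = G b x.
  have [/extend_step[G' Gd' GG']|] := pselect (extends_below d G); last by exists G.
  by exists G' => _; rewrite -addn1.
pose Gs := fix Gs (d : nat) : lmap (P t) N :=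
  if d is e.+1 then projT1 (cid (step e (Gs e))) else 0.
have GsS d : extends_below d%:Z (Gs d) -> extends_below d.+1%:Z (Gs d.+1) /\
    forall b (x : P t b), (b : int) < d%:Z -> Gs d.+1 b x = Gs d b x.
  by rewrite /=; case: cid.
have Gsd d : extends_below d%:Z (Gs d).
  by elim: d => [|d /GsS[]//] b x b0; rewrite [LHS](module_neg _ b0) [RHS](module_neg _ b0).
have Gs_stable d e b (x : P t b) : (b : int) < d%:Z -> Gs (d + e)%N b x = Gs d b x.
  move=> bd; elim: e => [|e <-]; rewrite ?addn0 // addnS.
  have [_ ->] // := GsS _ (Gsd (d + e)%N).
  by apply: lt_le_trans bd _; rewrite lez_nat leq_addr.
have Gs_eq d e b (x : P t b) : (b : int) < d%:Z -> b < e%:Z -> Gs d b x = Gs e b x.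
  by case: (leqP d e) => [/subnKC <-|/ltnW/subnKC <-] bd be; rewrite Gs_stable.
pose g b (x : P t b) := Gs `|(b : int)|.+1 b x.
have lt_abs (b : int) : b < `|b|.+1%:Z by lia.
have gD b x y : g b (x + y) = g b x + g b y by rewrite /g mappD.
have gN a b (q : rhom (r := Q) a b) (x : P t a) : g b (mact _ q x) = mact N q (g a x).
  (* A common stage beyond both degrees, where naturality is available. *)
  pose e := (`|(a : int)| + `|(b : int)|).+1.
  rewrite /g (@Gs_eq _ e b) ?(@Gs_eq `|(a : int)|.+1 e a) ?mapp_nat //; rewrite /e; lia.
exists (@MMap Q (P t) N g gD gN); apply: lmapP => b x.
exact: Gsd (lt_abs b).
Qed.
End Vanishing.

Theorem theorem4p6 (k : nat) (M N : lmodule (ringoidQk k))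
    (P : proj_resolution M) (s : nat) (hs : (k < s)%N) :
  forall x : Ext N P s, x = 0.
Proof.
move=> x; have [f ->] := qproj_surj x.
have -> : 0 = qproj (coboundaries N P s) 0 by rewrite -[0 in RHS](subrr 0) qprojB subrr.
apply/qproj_eq; rewrite subr0.
case: s hs f {x} => // t kt f.
rewrite ltnS in kt; have [g gf] := cocycle_extends kt (ssubP f).
by exists g.
Qed.
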